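(* Consider the entropy-split semi-discretization of the compressible Euler equations on a periodic domain which, on every element $\Omega_k$, reads $$\frac{d\boldsymbol{u}_k}{dt}+\frac{\beta}{\beta+1}\sum_{i=1}^{d}\overline{\mathsf D}_{x_ik}\boldsymbol f_k^{I(i)}+\frac{1}{\beta+1}\sum_{i=1}^{d}\tilde{\mathsf A}_{i}\overline{\mathsf D}_{x_ik}\boldsymbol w_k=\mathrm{SAT}^I_k,$$ $$\mathrm{SAT}^I_k=\overline{\mathsf H}_k^{-1}\sum_{i=1}^{d}\overline{\mathsf E}_{x_ik}\boldsymbol f_k^{I(i)}-\frac12\overline{\mathsf H}_k^{-1}\sum_{g\in\Gamma_k^I}\sum_{i=1}^{d}\left[\overline{\mathsf E}_{x_i}^{kv}\circ\mathsf F_i(\boldsymbol u_k,\boldsymbol u_v)\right]\boldsymbol 1 ,$$ where $\Omega_v$ is the neighbour of $\Omega_k$ across the facet $g$. This discretization is consistent and high-order accurate: for sufficiently smooth solutions it approximates the Euler equations to the design order of accuracy, i.e. if $\mathcal U$ is a sufficiently smooth solution and $\boldsymbol u_k,\boldsymbol f_k^{I(i)},\boldsymbol w_k,\tilde{\mathsf A}_i$ are the corresponding nodal values, then at the nodes of every element $$\frac{\beta}{\beta+1}\sum_{i=1}^{d}\overline{\mathsf D}_{x_ik}\boldsymbol f_k^{I(i)}+\frac{1}{\beta+1}\sum_{i=1}^{d}\tilde{\mathsf A}_{i}\overline{\mathsf D}_{x_ik}\boldsymbol w_k-\mathrm{SAT}^I_k=\sum_{i=1}^d\frac{\partial \mathcal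 F^{I(i)}}{\partial x_i}+\mathcal O(h^p).$$
   Context: **Euler equations and Harten entropy.** Let $d\in\{1,2,3\}$, $\gamma=7/5$, $n_c=d+2$. Conservative variables: $\mathcal U=(\rho,\rho V_1,\dots,\rho V_d,e)^T$ with $\rho>0$, $p>0$, $e=p/(\gamma-1)+\tfrac12\rho V^TV$ (the symbol $p$ also denotes the polynomial degree of the operators; meaning is clear from context). Inviscid fluxes: $\mathcal F^{I(i)}=(\rho V_i,\ \rho V_iV_1+\delta_{i1}p,\dots,\rho V_iV_d+\delta_{id}p,\ (e+p)V_i)^T$. Euler equations: $\partial_t\mathcal U+\sum_i\partial_{x_i}\mathcal F^{I(i)}=0$. Let $\alpha\in\mathbb R$ with $\alpha>0$ or $\alpha<-\gamma$ and $\beta=-(\gamma+\alpha)/(\gamma-1)$. Harten's entropy: $\mathcal S=\beta\rho(p\rho^{-\gamma})^{1/(\alpha+\gamma)}$; entropy variables $\mathcal W=(\partial\mathcal S/\partial\mathcal U)^T$, explicitly $\mathcal W^T=\frac{\rho}{p}(p\rho^{-\gamma})^{\frac1{\alpha+\gamma}}\left[-\frac{\alpha}{\gamma-1}\frac p\rho-\frac12V^TV,\ V^T,\ -1\right]$. The map $\mathcal U\mapsto\mathcal W$ is bijective onto its image, and $\tilde{\mathsf A}_i=\partial\mathcal F^{I(i)}/\partial\mathcal W$, which is symmetric. **Mesh and SBP operators.** The periodic domain $\Omega$ is tessellated into conforming, non-overlapping elements $\mathcal T_h=\{\Omega_k\}$ with piecewise smooth boundaries, obtained from a reference element by a bijective,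 time-independent polynomial mapping of degree $p_{\rm geom}\le p+1$ in 2D and $p_{\rm geom}\le\lfloor p/2\rfloor+1$ in 3D. By periodicity every facet is interior; $\Gamma_k^I$ is the set of facets of $\Omega_k$. Element $\Omega_k$ has $n_p$ nodes $S_k=\{\boldsymbol x_j\}$; $h=\max_{a,b\in S_k}\|a-b\|_2$ is the nominal element size. For each direction $i$, $\mathsf D_{x_ik}=\mathsf H_k^{-1}\mathsf Q_{x_ik}$ is a degree-$p$ SBP operator: (1) $\mathsf D_{x_ik}$ differentiates polynomials of total degree $\le p$ exactly at the nodes; (2) $\mathsf H_k$ is diagonal with positive entries, which are weights of a quadrature of degree at least $2p-1$; (3) $\mathsf Q_{x_ik}=\mathsf S_{x_ik}+\frac12\mathsf E_{x_ik}$ with $\mathsf S_{x_ik}$ skew-symmetric and $\mathsf E_{x_ik}$ diagonal, satisfying $\boldsymbol p^T\mathsf E_{x_ik}\boldsymbol q=\int_{\partial\Omega_k}\mathcal P\mathcal Q\,n_{x_i}\,d\Gamma$ for polynomials $\mathcal P,\mathcal Q$ of degree $\le r$, $r\ge p$. On elements obtained from the reference element by a bijective, time-independent polynomial mapping of degree $p_{\rm geom}\le p+1$ in 2D and $p_{\rm geom}\le\lfloor p/2\rfloor+1$ in 3D, the operators are constructed so that $\mathsf D_{x_ik}\boldsymbol u=\partial\mathcal U/\partial x_i+\mathcal O(h^p)$ at the nodes for the restriction $\boldsymbol u$ of any function in $C^{p+1}$. Facet nodes are a subset of the volume nodes: for a facet $g$ of $\Omega_k$, $\mathsf R_{gk}$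 is the matrix selecting the volume-node values at the $n_f$ facet nodes (facet nodes of adjacent elements coincide and are ordered identically), $\mathsf B_g$ is the diagonal matrix of positive facet quadrature weights (degree at least $2p$), $\mathsf N_{x_ig}$ the diagonal matrix of the $i$-th components of the unit normal on $g$ outward to $\Omega_k$, and $\mathsf E_{x_ik}=\sum_{g}\mathsf E_{x_i}^{kk}$ with $\mathsf E_{x_i}^{kk}=\mathsf R_{gk}^T\mathsf B_g\mathsf N_{x_ig}\mathsf R_{gk}$. If $\Omega_v$ shares $g$ with $\Omega_k$, $\mathsf E_{x_i}^{kv}=\mathsf R_{gk}^T\mathsf B_g\mathsf N_{x_ig}\mathsf R_{gv}$. An overbar denotes $\otimes\,\mathsf I_{n_c}$ (e.g. $\overline{\mathsf D}=\mathsf D\otimes\mathsf I_{n_c}$), $\circ$ is the Hadamard product, $\boldsymbol 1$ the vector of ones. **Nodal quantities.** $\boldsymbol u_k$ stacks the nodal values $\boldsymbol u_{k,m}\in\mathbb R^{n_c}$ of $\mathcal U$; $\boldsymbol f_k^{I(i)}$ and $\boldsymbol w_k$ stack the values of $\mathcal F^{I(i)}$ and $\mathcal W$ at $\boldsymbol u_{k,m}$; in the discretization $\tilde{\mathsf A}_i$ is the block-diagonal matrix with $n_c\times n_c$ blocks $\tilde{\mathsf A}_i(\boldsymbol u_{k,m})$. **Two-point flux.** $\mathsf F_i(\boldsymbol u_k,\boldsymbol u_v)$ is the block matrix with $(m,n)$ block $2\,\mathrm{diag}[\mathcal F_i^*(\boldsymbol u_{k,m},\boldsymbol u_{v,n})]$,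 where $\mathcal F_i^*$ is the Sjögreen–Yee two-point flux: with $\boldsymbol z=(\frac\rho p(p\rho^{-\gamma})^{1/(\alpha+\gamma)},V^T,p)^T$, $\{u\}=\frac12(u'+u'')$ and $\{u^{r-1}\}_e=\frac1r\frac{(u')^r-(u'')^r}{u'-u''}$ (extended by continuity), $[\mathcal F_i^*]_1=\frac{\{z_1z_{i+1}\}}{\{z_1^{-\gamma/\alpha}\}\{z_{n_c}^{(1-\gamma-\alpha)/\alpha}\}_e}$, $[\mathcal F_i^*]_j=[\mathcal F_i^*]_1\{z_j\}+\delta_{(i+1)j}\{z_{n_c}\}$ for $2\le j\le n_c-1$, $[\mathcal F_i^*]_{n_c}=[\mathcal F_i^*]_1\left(\frac{\gamma}{\gamma-1}\{z_{n_c}^{-(\gamma-1)/\alpha}\}\{z_1^{-(\gamma+\alpha)/\alpha}\}_e+\sum_{j=2}^{n_c-1}\{z_j\}^2-\frac12\{\sum_{j=2}^{n_c-1}z_j^2\}\right)$. It is consistent, $\mathcal F_i^*(\mathcal U,\mathcal U)=\mathcal F^{I(i)}(\mathcal U)$, and symmetric in its arguments. $\mathcal O(h^p)$ is understood entrywise as $h\to0$. *)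

(* Defs.v *)
From HB Require Import structures.
From mathcomp Require Import all_boot all_order all_algebra.
From mathcomp Require mpoly.

Set Implicit Arguments.
Unset Strict Implicit.
Unset Printing Implicit Defensive.

Import Order.TTheory GRing.Theory Num.Theory.

(* The notations of [mpoly] clash with those of MathComp-Analysis, so it is
   imported in this module only. *)
Module MPoly.
Import mpoly.

Local Open Scope ring_scope.

Definition mvpoly (R : nzRingType) (d : nat) : Type := {mpoly R[d]}.

Definition peval (R : nzRingType) (d : nat) (P : mvpoly R d)
    (x : 'rV[R]_d) : R :=
  P.@[fun i => x 0 i].

Definition pderiv (R : nzRingType) (d : nat) (i : 'I_d) (P : mvpoly R d) :
    mvpoly R d :=
  mderiv i P.

(* Total degree less than n ([msize] is the total degree plus one). *)
Definition deg_lt (R : nzRingType) (d n : nat) (P : mvpoly R d) : bool :=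
  (msize P <= n)%N.

End MPoly.
Import MPoly.

From mathcomp Require Import all_classical all_reals all_analysis.
From mathcomp Require Import mxtens.

Import numFieldNormedType.Exports.

Local Open Scope classical_set_scope.
Local Open Scope ring_scope.

Definition partial (R : realType) (n : nat) (f : 'rV[R]_n -> R) (i : 'I_n)
    (x : 'rV[R]_n) : R :=
  'D_(delta_mx 0 i) f x.

Fixpoint Cn (R : realType) (n k : nat) (f : 'rV[R]_n -> R) : Prop :=
  if k is k'.+1 then
    (forall x, differentiable f x) /\ (forall i, Cn k' (partial f i))
  else continuous f.

(* The norm of the library on ['rV_n] is the sup norm. *)
Definition enorm (R : realType) (n : nat) (x : 'rV[R]_n) : R :=
  Num.sqrt (\sum_i x 0 i ^+ 2).

(* Lebesgue integral over R^n as an iterated integral; it is only applied to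
   continuous functions cut off by the indicator of a compact set, for which it
   is the integral against the product measure. *)
Fixpoint iint (R : realType) (n : nat) : ('rV[R]_n -> R) -> R :=
  match n return ('rV[R]_n -> R) -> R with
  | 0%N => fun f => f 0
  | n'.+1 => fun f =>
      \int[lebesgue_measure]_(t in setT)
        iint (fun s : 'rV[R]_n' => f (row_mx (t%:M : 'rV[R]_1) s))
  end.

Definition vol_int (R : realType) (d : nat) (A : set 'rV[R]_d)
    (f : 'rV[R]_d -> R) : R :=
  iint (fun x => \1_A x * f x).

(* Generalized cross product of the tangent vectors of a parametrized
   hypersurface; for d = 1 there are no tangents and it is 1. *)
Definition cross (R : realType) (d : nat) (gam : 'rV[R]_d.-1 -> 'rV[R]_d)
    (s : 'rV[R]_d.-1) : 'rV[R]_d :=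
  let T := \matrix_(a < d.-1, i < d) partial (fun s' => gam s' 0 i) a s in
  \row_i ((-1) ^+ i * \det (col' i T)).

(* Integral against the surface measure of [gam @` K] of a function given on the
   parameter domain [K]. *)
Definition surf_int (R : realType) (d : nat) (gam : 'rV[R]_d.-1 -> 'rV[R]_d)
    (K : set 'rV[R]_d.-1) (f : 'rV[R]_d.-1 -> R) : R :=
  iint (fun s => \1_K s * (f s * enorm (cross gam s))).

(* A state is a row vector (rho, rho V_1, .., rho V_d, e): the index 0 carries
   the density, [vidx i] the i-th momentum and [ord_max] the total energy. *)

Definition vidx (d : nat) (i : 'I_d) : 'I_d.+2 := inord i.+1.

Definition gamma (R : realType) : R := 7%:R / 5%:R.

Definition beta (R : realType) (alpha : R) : R :=
  - (gamma R + alpha) / (gamma R - 1).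

Definition density (R : realType) (d : nat) (U : 'rV[R]_d.+2) : R := U 0 ord0.

Definition velocity (R : realType) (d : nat) (U : 'rV[R]_d.+2) (i : 'I_d) : R :=
  U 0 (vidx i) / density U.

Definition energy (R : realType) (d : nat) (U : 'rV[R]_d.+2) : R :=
  U 0 ord_max.

Definition pressure (R : realType) (d : nat) (U : 'rV[R]_d.+2) : R :=
  (gamma R - 1) *
  (energy U - 2%:R^-1 * density U * \sum_(i < d) velocity U i ^+ 2).

Definition admissible (R : realType) (d : nat) (U : 'rV[R]_d.+2) : Prop :=
  0 < density U /\ 0 < pressure U.

(* In the middle components, [U 0 c * velocity U i] is rho V_i V_c. *)
Definition flux (R : realType) (d : nat) (i : 'I_d) (U : 'rV[R]_d.+2) :
    'rV[R]_d.+2 :=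
  \row_c (if c == ord0 then density U * velocity U i
          else if c == ord_max then (energy U + pressure U) * velocity U i
          else U 0 c * velocity U i + (c == vidx i)%:R * pressure U).

Definition harten_entropy (R : realType) (d : nat) (alpha : R)
    (U : 'rV[R]_d.+2) : R :=
  beta alpha * density U *
  (pressure U * density U `^ (- gamma R)) `^ (alpha + gamma R)^-1.

Definition entropy_var (R : realType) (d : nat) (alpha : R) (U : 'rV[R]_d.+2) :
    'rV[R]_d.+2 :=
  \row_c partial (harten_entropy alpha) c U.

(* The inverse of U |-> W on the admissible states; junk off the image. *)
Definition conservative_of (R : realType) (d : nat) (alpha : R)
    (W : 'rV[R]_d.+2) : 'rV[R]_d.+2 :=
  xget 0 [set U | admissible U /\ entropy_var alpha U = W].

(* The Jacobian of the flux as a function of the entropy variables, at W(U). *)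
Definition Atilde (R : realType) (d : nat) (alpha : R) (i : 'I_d)
    (U : 'rV[R]_d.+2) : 'M[R]_d.+2 :=
  \matrix_(a, b)
    partial (fun W => flux i (conservative_of alpha W) 0 a) b
      (entropy_var alpha U).

Definition avg (R : realType) (a b : R) : R := (a + b) / 2%:R.

(* {u^s}_e with s = r - 1; the exponents used below are never -1. *)
Definition eavg (R : realType) (s a b : R) : R :=
  if a == b then a `^ s
  else (s + 1)^-1 * ((a `^ (s + 1) - b `^ (s + 1)) / (a - b)).

Definition zvec (R : realType) (d : nat) (alpha : R) (U : 'rV[R]_d.+2) :
    'rV[R]_d.+2 :=
  \row_c (if c == ord0 then
            density U / pressure U *
            (pressure U * density U `^ (- gamma R)) `^ (alpha + gamma R)^-1
          else if c == ord_max then pressure U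
          else U 0 c / density U).

Definition two_point_flux (R : realType) (d : nat) (alpha : R) (i : 'I_d)
    (U1 U2 : 'rV[R]_d.+2) : 'rV[R]_d.+2 :=
  let g := gamma R in
  let z1 c := zvec alpha U1 0 c in
  let z2 c := zvec alpha U2 0 c in
  let F1 :=
    avg (z1 ord0 * z1 (vidx i)) (z2 ord0 * z2 (vidx i)) /
    (avg (z1 ord0 `^ (- g / alpha)) (z2 ord0 `^ (- g / alpha)) *
     eavg ((1 - g - alpha) / alpha) (z1 ord_max) (z2 ord_max)) in
  \row_c
    (if c == ord0 then F1
     else if c == ord_max then
       F1 * (g / (g - 1) *
             avg (z1 ord_max `^ (- (g - 1) / alpha))
                 (z2 ord_max `^ (- (g - 1) / alpha)) *
             eavg (- (g + alpha) / alpha) (z1 ord0) (z2 ord0)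
             + \sum_(j < d) avg (z1 (vidx j)) (z2 (vidx j)) ^+ 2
             - 2%:R^-1 * avg (\sum_(j < d) z1 (vidx j) ^+ 2)
                             (\sum_(j < d) z2 (vidx j) ^+ 2))
     else F1 * avg (z1 c) (z2 c)
          + (c == vidx i)%:R * avg (z1 ord_max) (z2 ord_max)).

(* The periodic domain is R^d modulo the lattice spanned by the rows of [L]. *)
Definition lat (R : realType) (d : nat) (L : 'M[R]_d) (z : 'rV[int]_d) :
    'rV[R]_d :=
  map_mx (fun n : int => n%:~R) z *m L.

Definition periodic (R : realType) (d : nat) (L : 'M[R]_d) (T : Type)
    (f : 'rV[R]_d -> T) : Prop :=
  forall x z, f (x + lat L z) = f x.

(* Each facet of the reference element is parametrized over a subset of
   R^(d-1). *)
Record ref_element (R : realType) (d nfac : nat) := RefElement {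
  ref_dom : set 'rV[R]_d;
  ref_pdom : 'I_nfac -> set 'rV[R]_d.-1;
  ref_par : 'I_nfac -> 'rV[R]_d.-1 -> 'rV[R]_d
}.

Record is_ref_element (R : realType) (d nfac : nat)
    (E : ref_element R d nfac) : Prop := IsRefElement {
  ref_compact : compact (ref_dom E);
  ref_nonempty : ref_dom E !=set0;
  ref_regular : closure (interior (ref_dom E)) = ref_dom E;
  ref_pdom_compact : forall g, compact (ref_pdom E g);
  ref_pdom_nonempty : forall g, ref_pdom E g !=set0;
  ref_pdom_regular : forall g,
    closure (interior (ref_pdom E g)) = ref_pdom E g;
  ref_par_smooth : forall g k i, Cn k (fun s => ref_par E g s 0 i);
  ref_par_inj : forall g s s', ref_pdom E g s -> ref_pdom E g s' ->
    ref_par E g s = ref_par E g s' -> s = s';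
  ref_boundary : ref_dom E `\` interior (ref_dom E) =
    \bigcup_(g in [set: 'I_nfac]) (ref_par E g @` ref_pdom E g);
  ref_facets_nonoverlap : forall g g' s s',
    interior (ref_pdom E g) s -> ref_pdom E g' s' ->
    ref_par E g s = ref_par E g' s' -> g = g'
}.

(* A mesh with its nodes and operators. Element k is the image of the reference
   element under [emap k]; [forient k g] picks the sign making the cross product
   of the tangents of facet g point out of k. [fpar k g j] is the parameter of
   the j-th facet node, which is the volume node [fnode k g j]. Facet g of k is
   facet [(nbr k g).2] of [(nbr k g).1], translated by the period [shift k g]. *)
Record mesh (R : realType) (d np nf nfac : nat) := Mesh {
  nelt : nat;
  emap : 'I_nelt -> 'I_d -> mvpoly R d;
  node : 'I_nelt -> 'I_np -> 'rV[R]_d;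
  forient : 'I_nelt -> 'I_nfac -> bool;
  fnode : 'I_nelt -> 'I_nfac -> 'I_nf -> 'I_np;
  fpar : 'I_nelt -> 'I_nfac -> 'I_nf -> 'rV[R]_d.-1;
  nbr : 'I_nelt -> 'I_nfac -> 'I_nelt * 'I_nfac;
  shift : 'I_nelt -> 'I_nfac -> 'rV[int]_d;
  Hmx : 'I_nelt -> 'M[R]_np;
  Smx : 'I_nelt -> 'I_d -> 'M[R]_np;
  Bmx : 'I_nelt -> 'I_nfac -> 'M[R]_nf
}.

Section MeshGeometry.
Context (R : realType) (d np nf nfac : nat).
Context (E : ref_element R d nfac) (M : mesh R d np nf nfac).

Definition emap_fun (k : 'I_(nelt M)) (y : 'rV[R]_d) : 'rV[R]_d :=
  \row_i peval (emap k i) y.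

Definition elt (k : 'I_(nelt M)) : set 'rV[R]_d := emap_fun k @` ref_dom E.

Definition fmap (k : 'I_(nelt M)) (g : 'I_nfac) (s : 'rV[R]_d.-1) :
    'rV[R]_d :=
  emap_fun k (ref_par E g s).

Definition facet (k : 'I_(nelt M)) (g : 'I_nfac) : set 'rV[R]_d :=
  fmap k g @` ref_pdom E g.

Definition normal (k : 'I_(nelt M)) (g : 'I_nfac) (s : 'rV[R]_d.-1) :
    'rV[R]_d :=
  let N := cross (fmap k g) s in (-1) ^+ forient k g *: ((enorm N)^-1 *: N).

Definition hsize (k : 'I_(nelt M)) : R :=
  \big[Num.max/0]_(a < np) \big[Num.max/0]_(b < np)
    enorm (node k a - node k b).

Definition Rmx (k : 'I_(nelt M)) (g : 'I_nfac) : 'M[R]_(nf, np) :=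
  \matrix_(j, m) (m == fnode k g j)%:R.

Definition Nmx (i : 'I_d) (k : 'I_(nelt M)) (g : 'I_nfac) : 'M[R]_nf :=
  diag_mx (\row_j normal k g (fpar k g j) 0 i).

Definition Ekk (i : 'I_d) (k : 'I_(nelt M)) (g : 'I_nfac) : 'M[R]_np :=
  (Rmx k g)^T *m Bmx k g *m Nmx i k g *m Rmx k g.

Definition Ekv (i : 'I_d) (k : 'I_(nelt M)) (g : 'I_nfac) : 'M[R]_np :=
  (Rmx k g)^T *m Bmx k g *m Nmx i k g *m Rmx (nbr k g).1 (nbr k g).2.

Definition Emx (i : 'I_d) (k : 'I_(nelt M)) : 'M[R]_np := \sum_g Ekk i k g.

Definition Qmx (i : 'I_d) (k : 'I_(nelt M)) : 'M[R]_np :=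
  Smx k i + 2%:R^-1 *: Emx i k.

Definition Dmx (i : 'I_d) (k : 'I_(nelt M)) : 'M[R]_np :=
  invmx (Hmx k) *m Qmx i k.

Definition restr (k : 'I_(nelt M)) (f : 'rV[R]_d -> R) : 'cV[R]_np :=
  \col_m f (node k m).

End MeshGeometry.

Record is_tessellation (R : realType) (d np nf nfac : nat) (L : 'M[R]_d)
    (pgeom : nat) (E : ref_element R d nfac) (M : mesh R d np nf nfac) :
    Prop := IsTessellation {
  emap_deg : forall (k : 'I_(nelt M)) i, deg_lt pgeom.+1 (emap k i);
  emap_inj : forall k y y', ref_dom E y -> ref_dom E y' ->
    emap_fun (M := M) k y = emap_fun k y' -> y = y';
  facet_regular : forall (k : 'I_(nelt M)) g s, ref_pdom E g s ->
    cross (fmap E k g) s != 0;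
  facet_outward : forall (k : 'I_(nelt M)) g s, interior (ref_pdom E g) s ->
    exists2 e0 : R, 0 < e0 & forall e, 0 < e < e0 ->
      ~ elt E k (fmap E k g s + e *: normal E k g s) /\
      elt E k (fmap E k g s - e *: normal E k g s);
  elts_cover : forall x, exists (k : 'I_(nelt M)) y z,
    elt E k y /\ x = y + lat L z;
  elts_nonoverlap : forall (k v : 'I_(nelt M)) z x,
    interior (elt E k) x -> interior (elt E v) (x + lat L z) ->
    k = v /\ z = 0;
  (* conformity: every facet is a full facet of one neighbour *)
  facet_shared : forall (k : 'I_(nelt M)) g,
    facet E k g =
    [set y + lat L (shift k g) | y in facet E (nbr k g).1 (nbr k g).2];
  nbr_symm : forall (k : 'I_(nelt M)) g,
    nbr (nbr k g).1 (nbr k g).2 = (k, g) /\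
    shift (nbr k g).1 (nbr k g).2 = - shift k g;
  (* in the torus the neighbour may be a translate of the element itself *)
  nbr_distinct : forall (k : 'I_(nelt M)) g, (nbr k g).1 = k -> shift k g != 0
}.

Record are_nodes (R : realType) (d np nf nfac : nat) (L : 'M[R]_d)
    (E : ref_element R d nfac) (M : mesh R d np nf nfac) : Prop := AreNodes {
  node_in : forall (k : 'I_(nelt M)) m, elt E k (node k m);
  node_inj : forall k : 'I_(nelt M), injective (node k);
  fnode_inj : forall (k : 'I_(nelt M)) g, injective (fnode k g);
  fpar_in : forall (k : 'I_(nelt M)) g j, ref_pdom E g (fpar k g j);
  fpar_node : forall (k : 'I_(nelt M)) g j,
    fmap E k g (fpar k g j) = node k (fnode k g j);
  fnode_shared : forall (k : 'I_(nelt M)) g j,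
    node k (fnode k g j) =
    node (nbr k g).1 (fnode (nbr k g).1 (nbr k g).2 j) + lat L (shift k g)
}.

Record is_SBP (R : realType) (d np nf nfac : nat) (p : nat)
    (E : ref_element R d nfac) (M : mesh R d np nf nfac) : Prop := IsSBP {
  D_exact : forall (k : 'I_(nelt M)) i P, deg_lt p.+1 P ->
    Dmx E i k *m restr k (peval P) = restr k (peval (pderiv i P));
  H_diag : forall k : 'I_(nelt M), is_diag_mx (Hmx k);
  H_pos : forall (k : 'I_(nelt M)) m, 0 < Hmx k m m;
  H_quadrature : forall (k : 'I_(nelt M)) (P : mvpoly R d),
    deg_lt p.*2 P ->
    \sum_m Hmx k m m * peval P (node k m) = vol_int (elt E k) (peval P);
  S_skew : forall (k : 'I_(nelt M)) i, (Smx k i)^T = - Smx k i;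
  E_diag : forall (k : 'I_(nelt M)) i, is_diag_mx (Emx E i k);
  E_boundary : exists2 r, (p <= r)%N &
    forall (k : 'I_(nelt M)) i (P Q : mvpoly R d),
      deg_lt r.+1 P -> deg_lt r.+1 Q ->
      (restr k (peval P))^T *m Emx E i k *m restr k (peval Q) =
      (\sum_g surf_int (fmap E k g) (ref_pdom E g)
         (fun s => peval P (fmap E k g s) * peval Q (fmap E k g s) *
                   normal E k g s 0 i))%:M;
  B_diag : forall (k : 'I_(nelt M)) g, is_diag_mx (Bmx k g);
  B_pos : forall (k : 'I_(nelt M)) g j, 0 < Bmx k g j j;
  B_quadrature : forall (k : 'I_(nelt M)) g (P : mvpoly R d),
    deg_lt p.*2.+1 P ->
    \sum_j Bmx k g j j * peval P (node k (fnode k g j)) =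
    surf_int (fmap E k g) (ref_pdom E g) (fun s => peval P (fmap E k g s));
  B_shared : forall (k : 'I_(nelt M)) g,
    Bmx (nbr k g).1 (nbr k g).2 = Bmx k g
}.

(* [err] assigns a vector to each element of each mesh of a family; it is
   O(h^p), entrywise and as the element size h tends to 0. *)
Definition is_Ohp (R : realType) (d np nf nfac : nat) (J : Type)
    (M : J -> mesh R d np nf nfac) (p l : nat)
    (err : forall j, 'I_(nelt (M j)) -> 'cV[R]_l) : Prop :=
  exists C delta : R, 0 < delta /\
    forall j (k : 'I_(nelt (M j))), hsize k < delta ->
      forall a, `|err j k a 0| <= C * hsize k ^+ p.

Arguments is_Ohp {R d np nf nfac J} M p {l} err.

(* Functions on the periodic domain are identified with periodic functions on
   R^d. The constant of the O(h^p) may depend on [f], not on the mesh, the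
   element or the node. *)
Definition accurate_operators (R : realType) (d np nf nfac : nat)
    (L : 'M[R]_d) (p : nat) (E : ref_element R d nfac) (J : Type)
    (M : J -> mesh R d np nf nfac) : Prop :=
  forall (f : 'rV[R]_d -> R) (i : 'I_d), periodic L f -> Cn p.+1 f ->
    is_Ohp M p (fun j k =>
      Dmx E i k *m restr k f - restr k (partial f i)).

(* Nodal values stacked node by node, in the ordering of the Kronecker product
   [*t]. *)
Definition stack (R : realType) (np nc : nat) (g : 'I_np -> 'rV[R]_nc) :
    'cV[R]_(np * nc) :=
  \col_a g (mxtens_unindex a).1 0 (mxtens_unindex a).2.

Definition block_diag (R : realType) (np nc : nat) (A : 'I_np -> 'M[R]_nc) :
    'M[R]_(np * nc) :=
  \matrix_(a, b)
    let: (m, c) := mxtens_unindex a in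
    let: (n, c') := mxtens_unindex b in
    if m == n then A m c c' else 0.

Definition overbar (R : realType) (d np : nat) (A : 'M[R]_np) :
    'M[R]_(np * d.+2) :=
  A *t (1%:M : 'M[R]_d.+2).

Definition hadamard (R : realType) (m n : nat) (A B : 'M[R]_(m, n)) :
    'M[R]_(m, n) :=
  map2_mx *%R A B.

Definition Fmx (R : realType) (d np : nat) (alpha : R) (i : 'I_d)
    (uk uv : 'I_np -> 'rV[R]_d.+2) : 'M[R]_(np * d.+2) :=
  \matrix_(a, b)
    let: (m, c) := mxtens_unindex a in
    let: (n, c') := mxtens_unindex b in
    if c == c' then 2%:R * two_point_flux alpha i (uk m) (uv n) 0 c else 0.

Section Scheme.
Context (R : realType) (d np nf nfac : nat) (alpha : R).
Context (E : ref_element R d nfac) (M : mesh R d np nf nfac).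
Context (u : 'I_(nelt M) -> 'I_np -> 'rV[R]_d.+2).

Definition volume_terms (k : 'I_(nelt M)) : 'cV[R]_(np * d.+2) :=
  let f i := stack (fun m => flux i (u k m)) in
  let w := stack (fun m => entropy_var alpha (u k m)) in
  let A i := block_diag (fun m => Atilde alpha i (u k m)) in
  (beta alpha / (beta alpha + 1)) *:
    (\sum_(i < d) overbar d (Dmx E i k) *m f i)
  + (beta alpha + 1)^-1 *:
    (\sum_(i < d) A i *m (overbar d (Dmx E i k) *m w)).

Definition SAT (k : 'I_(nelt M)) : 'cV[R]_(np * d.+2) :=
  let f i := stack (fun m => flux i (u k m)) in
  invmx (overbar d (Hmx k)) *m
    (\sum_(i < d) overbar d (Emx E i k) *m f i)
  - 2%:R^-1 *:
    (invmx (overbar d (Hmx k)) *m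
     \sum_g \sum_(i < d)
       hadamard (overbar d (Ekv E i k g)) (Fmx alpha i (u k) (u (nbr k g).1))
         *m const_mx 1).

End Scheme.

Definition div_flux (R : realType) (d : nat) (U : 'rV[R]_d -> 'rV[R]_d.+2)
    (x : 'rV[R]_d) : 'rV[R]_d.+2 :=
  \row_c \sum_(i < d) partial (fun y => flux i (U y) 0 c) i x.

Definition dt (R : realType) (d : nat) (U : R -> 'rV[R]_d -> 'rV[R]_d.+2)
    (t : R) (x : 'rV[R]_d) : 'rV[R]_d.+2 :=
  \row_c derive1 (fun s => U s x 0 c) t.

Record euler_solution (R : realType) (d : nat) (L : 'M[R]_d) (T : set R)
    (U : R -> 'rV[R]_d -> 'rV[R]_d.+2) : Prop := EulerSolution {
  sol_periodic : forall t, T t -> periodic L (U t);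
  sol_admissible : forall t x, T t -> admissible (U t x);
  sol_derivable : forall t x c, T t -> derivable (fun s => U s x 0 c) t 1;
  sol_eq : forall t x, T t -> dt U t x + div_flux (U t) x = 0
}.

Definition nodal (R : realType) (d np nf nfac : nat)
    (M : mesh R d np nf nfac) (V : 'rV[R]_d -> 'rV[R]_d.+2)
    (k : 'I_(nelt M)) (m : 'I_np) : 'rV[R]_d.+2 :=
  V (node k m).

Arguments nodal {R d np nf nfac} M V k m.

(* Main.v *)
Require Import Defs.
From mathcomp Require Import all_boot all_order all_algebra.
From mathcomp Require Import all_classical all_reals all_analysis.
From mathcomp Require Import mxtens ring lra.
Import Order.TTheory GRing.Theory Num.Theory.
Import numFieldNormedType.Exports.
Local Open Scope classical_set_scope.
Local Open Scope ring_scope.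

Set Implicit Arguments.
Unset Strict Implicit.
Unset Printing Implicit Defensive.

(** On the nodal values of a smooth periodic solution the scheme differs from the
    Euler equations for one reason only, the truncation error of the
    differentiation operators.

    The penalty term vanishes identically ([SAT_eq0]): a facet node and its copy
    in the neighbouring element are equal modulo the periods, so both carry the
    same state, and the two-point flux of two equal states is the flux
    ([two_point_flux_consistent]).

    The volume term is a weighted sum of D f and A D w with weights
    beta / (beta+1) and 1 / (beta+1), whose sum is 1. The hypothesis on the
    operators replaces D f by the derivative of f and D w by that of w, up to
    O(h^p), because fluxes and entropy variables are C^(p+1) functions of x as
    soon as the state is ([Ck_on_flux], [Ck_on_entropy_var_closed]). The chain
    rule ([Atilde_chain]) identifies A dw/dx with df/dx, so that both halves
    approximate the flux divergence ([volume_error]). The error of D w is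
    multiplied by A, which is continuous and periodic, hence bounded uniformly
    in the mesh ([continuous_Atilde], [periodic_bounded]).

    The Jacobian A is a derivative with respect to the entropy variables W, so
    it has to be shown that U |-> W has a smooth inverse near each W(U). The
    entropy variables are computed in closed form ([entropy_varE]) and inverted
    explicitly on an open set ([state_ofK], [entropy_var_state_of],
    [conservative_ofE]). *)

(** * Calculus of functions of class C^k on a set *)

(** The value of a partial derivative together with total differentiability,
    which the chain rule needs and which partial derivatives alone do not
    give. *)
Definition has_partial {R : realType} {n : nat} (f : 'rV[R]_n -> R)
    (x : 'rV[R]_n) (i : 'I_n) (l : R) : Prop :=
  differentiable f x /\ partial f i x = l.

Section HasPartial.
Context {R : realType} {n : nat}.
Implicit Types (f g : 'rV[R]_n -> R) (x : 'rV[R]_n) (i : 'I_n).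

Lemma has_partialE f x i l :
  has_partial f x i l <-> differentiable f x /\ 'd f x (delta_mx 0 i) = l.
Proof.
by split=> -[df <-]; split=> //; rewrite /partial deriveE.
Qed.

Lemma has_partial_eq f x i l l' : has_partial f x i l -> l = l' ->
  has_partial f x i l'.
Proof. by move=> h <-. Qed.

Lemma has_partial_diff f df x i : is_diff x f df ->
  has_partial f x i (df (delta_mx 0 i)).
Proof.
by move=> [dfx dfE]; apply/has_partialE; rewrite dfE; split.
Qed.

Lemma has_partial_is_diff f x i l : has_partial f x i l ->
  is_diff x f ('d f x) /\ 'd f x (delta_mx 0 i) = l.
Proof. by move=> /has_partialE[df <-]; split=> //; exact/differentiableP. Qed.

Lemma has_partial_cst (c : R) x i : has_partial (fun=> c) x i 0.
Proof. exact: (@has_partial_diff (cst c) 0 x i (is_diff_cst c x)). Qed.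

Lemma has_partial_coord j x i :
  has_partial (fun y => y 0 j) x i (i == j)%:R.
Proof.
split; first exact: differentiable_coord.
have dj : 'D_(delta_mx 0 i) (@id 'rV[R]_n) x = delta_mx 0 i by rewrite derive_id.
have dij : derivable (@id 'rV[R]_n) x (delta_mx 0 i) by exact: derivable_id.
have := derive_mx dij; rewrite dj => /matrixP/(_ 0 j); rewrite !mxE /= => dijE.
by rewrite /partial -dijE eq_sym.
Qed.

Lemma has_partialD f g x i a b : has_partial f x i a -> has_partial g x i b ->
  has_partial (fun y => f y + g y) x i (a + b).
Proof.
move=> /has_partial_is_diff[fx <-] /has_partial_is_diff[gx <-].
exact: (@has_partial_diff _ _ x i (is_diffD fx gx)).
Qed.

Lemma has_partialM f g x i a b : has_partial f x i a -> has_partial g x i b ->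
  has_partial (fun y => f y * g y) x i (a * g x + f x * b).
Proof.
move=> /has_partial_is_diff[fx <-] /has_partial_is_diff[gx <-].
have := @has_partial_diff _ _ x i (is_diffM fx gx).
by move=> /has_partial_eq; apply; rewrite addrC [X in _ = X + _]mulrC.
Qed.

Lemma has_partial_comp (phi : R -> R) f x i a b :
  is_derive (f x) 1 phi b -> has_partial f x i a ->
  has_partial (fun y => phi (f y)) x i (b * a).
Proof.
move=> [dphi phiE] /has_partialE[df <-].
have dphi' : differentiable phi (f x) by exact/derivable1_diffP.
apply/has_partialE; split; first exact: (differentiable_comp df dphi').
by rewrite (diff_comp df dphi') /= deriv1E // derive1E phiE mulrC.
Qed.

Lemma has_partialV f x i a : f x != 0 -> has_partial f x i a ->
  has_partial (fun y => (f y)^-1) x i (- (f x)^-1 * (f x)^-1 * a).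
Proof.
move=> fx0 /has_partialE[df <-]; apply/has_partialE.
split; first exact: differentiableV.
by rewrite diffV //= mulNr -invfM -expr2.
Qed.

Lemma has_partial_powR f s x i a : 0 < f x -> has_partial f x i a ->
  has_partial (fun y => f y `^ s) x i (s * f x `^ (s - 1) * a).
Proof.
move=> fx0; apply: (has_partial_comp (phi := fun z => z `^ s)).
exact: is_derive1_powR.
Qed.

Lemma has_partial_sum m (f : 'I_m -> 'rV[R]_n -> R) (df : 'I_m -> R) x i :
  (forall j, has_partial (f j) x i (df j)) ->
  has_partial (fun y => \sum_j f j y) x i (\sum_j df j).
Proof.
elim: m f df => [|m IH] f df fdf.
  under [X in has_partial X]eq_fun do rewrite big_ord0.
  by rewrite big_ord0; exact: has_partial_cst.
under [X in has_partial X]eq_fun do rewrite big_ord_recl.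
by rewrite big_ord_recl; apply: has_partialD => //; exact: IH.
Qed.

Lemma differentiable_row m (w : 'rV[R]_n -> 'rV[R]_m) x :
  (forall b, differentiable (fun y => w y 0 b) x) -> differentiable w x.
Proof.
move=> dw.
have -> : w = \sum_b (fun y => w y 0 b *: (delta_mx 0 b : 'rV[R]_m)).
  by apply/funext => y; rewrite fct_sumE [LHS]row_sum_delta.
by apply: differentiable_sum => b; apply: differentiableZl; exact: dw.
Qed.

(** Chain rule: the outer differential is expanded on the canonical basis. *)
Lemma has_partial_chain m (G : 'rV[R]_m -> R) (w : 'rV[R]_n -> 'rV[R]_m) x i :
  (forall b, differentiable (fun y => w y 0 b) x) -> differentiable G (w x) ->
  has_partial (fun y => G (w y)) x i
    (\sum_b partial G b (w x) * partial (fun y => w y 0 b) i x).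
Proof.
move=> dw dG; have dwx := differentiable_row dw.
apply/has_partialE; split; first exact: (differentiable_comp dwx dG).
rewrite (diff_comp dwx dG) /=.
have -> : 'd w x (delta_mx 0 i) =
    \sum_b partial (fun y => w y 0 b) i x *: (delta_mx 0 b : 'rV[R]_m).
  rewrite -deriveE // derive_mx; last exact: diff_derivable.
  by rewrite [LHS]row_sum_delta; apply: eq_bigr => b _; rewrite mxE.
rewrite linear_sum; apply: eq_bigr => b _; rewrite linearZ /= mulrC.
by rewrite [partial G b _]deriveE.
Qed.

End HasPartial.

(** Class C^k on D. Quantifying over the family of partial derivatives,
    instead of naming them, makes the class stable under the usual rules of
    differentiation without any openness assumption on D: a formula for the
    derivative that is valid on D only is a legitimate witness. *)
Fixpoint Ck_on {R : realType} {n : nat} (k : nat) (D : set 'rV[R]_n)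
    (f : 'rV[R]_n -> R) : Prop :=
  if k is k'.+1 then
    (forall x, D x -> differentiable f x) /\
    exists df : 'I_n -> 'rV[R]_n -> R, forall i,
      (forall x, D x -> has_partial f x i (df i x)) /\ Ck_on k' D (df i)
  else forall x, D x -> {for x, continuous f}.

Section CkOn.
Context {R : realType} {n : nat}.
Implicit Types (f g : 'rV[R]_n -> R) (D : set 'rV[R]_n) (k : nat).

Lemma Cn_Ck_on k f : Cn k f <-> Ck_on k setT f.
Proof.
elim: k f => [|k IH] f /=; first by split=> [h x _|h x]; exact: h.
split=> [[df pf]|[df [pf hpf]]].
  split=> [x _|]; first exact: df.
  by exists (partial f) => i; split=> [x _|]; [split|exact/IH].
split=> [x|i]; first exact: df.
have -> : partial f i = pf i by apply/funext => x; case: ((hpf i).1 x).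
by apply/IH; case: (hpf i).
Qed.

Lemma Ck_on_continuous k D f : Ck_on k D f ->
  forall x, D x -> {for x, continuous f}.
Proof.
case: k => [//|k] [df _] x Dx.
exact: differentiable_continuous (df x Dx).
Qed.

Lemma Ck_onW k D f : Ck_on k.+1 D f -> Ck_on k D f.
Proof.
elim: k f => [|k IH] f; first exact: Ck_on_continuous.
move=> [df [pf hpf]]; split=> //; exists pf => i.
by have [? ?] := hpf i; split=> //; exact: IH.
Qed.

Lemma Ck_on_cst k D (c : R) : Ck_on k D (fun=> c).
Proof.
elim: k c => [|k IH] c /=; first by move=> x _; exact: cst_continuous.
split=> [x _|]; first exact: differentiable_cst.
by exists (fun _ _ => 0) => i; split=> // x _; exact: has_partial_cst.
Qed.

Lemma Ck_on_coord k D j : Ck_on k D (fun y => y 0 j).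
Proof.
case: k => [|k] /=; first by move=> x _; exact: coord_continuous.
split=> [x _|]; first exact: differentiable_coord.
exists (fun i _ => (i == j)%:R) => i.
by split=> [x _|]; [exact: has_partial_coord|exact: Ck_on_cst].
Qed.

Lemma Ck_onD k D f g : Ck_on k D f -> Ck_on k D g ->
  Ck_on k D (fun y => f y + g y).
Proof.
elim: k f g => [|k IH] f g.
  by move=> cf cg x Dx; exact: (continuousD (cf x Dx) (cg x Dx)).
move=> [df [pf hf]] [dg [pg hg]]; split=> [x Dx|].
  exact: (differentiableD (df x Dx) (dg x Dx)).
exists (fun i y => pf i y + pg i y) => i.
have [pfE cf] := hf i; have [pgE cg] := hg i.
by split=> [x Dx|]; [apply: has_partialD; auto|exact: IH].
Qed.

Lemma Ck_onM k D f g : Ck_on k D f -> Ck_on k D g ->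
  Ck_on k D (fun y => f y * g y).
Proof.
elim: k f g => [|k IH] f g.
  by move=> cf cg x Dx; exact: (continuousM (cf x Dx) (cg x Dx)).
move=> cf1 cg1; have cf0 := Ck_onW cf1; have cg0 := Ck_onW cg1.
move: cf1 cg1 => [df [pf hf]] [dg [pg hg]]; split=> [x Dx|].
  exact: (differentiableM (df x Dx) (dg x Dx)).
exists (fun i y => pf i y * g y + f y * pg i y) => i.
have [pfE cf] := hf i; have [pgE cg] := hg i.
split=> [x Dx|]; first by apply: has_partialM; auto.
by apply: Ck_onD; exact: IH.
Qed.

Lemma Ck_onN k D f : Ck_on k D f -> Ck_on k D (fun y => - f y).
Proof.
move=> cf; rewrite (_ : (fun _ => _) = (fun y => -1 * f y)).
  by apply: Ck_onM => //; exact: Ck_on_cst.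
by apply/funext => y; rewrite mulN1r.
Qed.

Lemma Ck_onB k D f g : Ck_on k D f -> Ck_on k D g ->
  Ck_on k D (fun y => f y - g y).
Proof. by move=> cf cg; apply: Ck_onD => //; exact: Ck_onN. Qed.

Lemma Ck_onX k D f m : Ck_on k D f -> Ck_on k D (fun y => f y ^+ m).
Proof.
move=> cf; elim: m => [|m IH].
  by under eq_fun do rewrite expr0; exact: Ck_on_cst.
by under eq_fun do rewrite exprS; exact: Ck_onM.
Qed.

Lemma Ck_on_sum k D m (f : 'I_m -> 'rV[R]_n -> R) :
  (forall j, Ck_on k D (f j)) -> Ck_on k D (fun y => \sum_j f j y).
Proof.
elim: m f => [|m IH] f cf.
  by under [X in Ck_on _ _ X]eq_fun do rewrite big_ord0; exact: Ck_on_cst.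
under [X in Ck_on _ _ X]eq_fun do rewrite big_ord_recl.
by apply: Ck_onD => //; exact: IH.
Qed.

Lemma Ck_onV k D f : (forall x, D x -> f x != 0) -> Ck_on k D f ->
  Ck_on k D (fun y => (f y)^-1).
Proof.
move=> f0; elim: k => [|k IH].
  by move=> cf x Dx; exact: (continuousV (f0 x Dx) (cf x Dx)).
move=> cf; have cVf := IH (Ck_onW cf); move: cf => [df [pf hf]].
split=> [x Dx|]; first exact: differentiableV (df x Dx) (f0 x Dx).
exists (fun i y => - (f y)^-1 * (f y)^-1 * pf i y) => i; have [pfE cf] := hf i.
split=> [x Dx|]; first by apply: has_partialV; auto.
by do !apply: Ck_onM => //; exact: Ck_onN.
Qed.

Lemma Ck_on_powR k D f s : (forall x, D x -> 0 < f x) -> Ck_on k D f ->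
  Ck_on k D (fun y => f y `^ s).
Proof.
move=> f0; elim: k s => [|k IH] s.
  move=> cf x Dx; apply: (@continuous_comp _ _ _ f (fun z => z `^ s)).
    exact: cf.
  apply: differentiable_continuous; apply/derivable1_diffP.
  by have [] := is_derive1_powR s (f0 x Dx).
move=> cf; have cVf := IH ^~ (Ck_onW cf); move: cf => [df [pf hf]].
split=> [x Dx|].
  apply: (@differentiable_comp _ _ _ _ f (fun z => z `^ s)); first exact: df.
  by apply/derivable1_diffP; have [] := is_derive1_powR s (f0 x Dx).
exists (fun i y => s * f y `^ (s - 1) * pf i y) => i; have [pfE cf] := hf i.
split=> [x Dx|]; first by apply: has_partial_powR; auto.
by do !apply: Ck_onM => //; exact: Ck_on_cst.
Qed.

(** Positivity of a continuous function is an open condition. *)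
Lemma open_gt0 D f : open D -> Ck_on 0 D f -> open [set x | D x /\ 0 < f x].
Proof.
move=> oD cf; rewrite openE => x [Dx fx0].
have nD : nbhs x D by exact: open_nbhs_nbhs.
have nf : \forall y \near x, 0 < f y.
  exact: (cf x Dx [set z | 0 < z] (lt_nbhsr fx0)).
by near=> y; split; near: y.
Unshelve. all: by end_near. Qed.

End CkOn.

(** * Power identities for Harten's entropy *)

Section PowerIdentities.
Context {R : realType}.
Implicit Types (alpha a r q w th : R).
Local Notation g := (gamma R).

Lemma gamma_gt1 : 0 < g - 1.
Proof. by rewrite /gamma; lra. Qed.

Lemma gammaB1_neq0 : g - 1 != 0.
Proof. by rewrite gt_eqF // gamma_gt1. Qed.

Definition harten_parameter alpha : Prop := 0 < alpha \/ alpha < - g.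

Lemma harten_parameter_neq0 alpha : harten_parameter alpha ->
  [/\ alpha != 0, alpha + g != 0 & alpha + 1 != 0].
Proof.
have g1 := gamma_gt1.
by case=> ha; split; (try by rewrite gt_eqF //; lra); rewrite lt_eqF //; lra.
Qed.

(* All the identities below are between products of real powers of positive
   numbers; the logarithm turns them into linear identities in the logarithms
   of density and pressure. *)

Lemma lnM_gt0 a b : 0 < a -> 0 < b -> ln (a * b) = ln a + ln b.
Proof. by move=> a0 b0; rewrite lnM ?posrE. Qed.

Lemma lnV_gt0 a : 0 < a -> ln a^-1 = - ln a.
Proof. by move=> a0; rewrite lnV ?posrE. Qed.

Lemma ln_inj_gt0 a b : 0 < a -> 0 < b -> ln a = ln b -> a = b.
Proof. by move=> a0 b0; apply: ln_inj; rewrite posrE. Qed.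

(** The first component of the parameter vector z, which is also minus the last
    entropy variable, as a function of density and pressure. *)
Definition zfac alpha r q := r / q * (q * r `^ (- g)) `^ (alpha + g)^-1.

Section Positive.
Variables (alpha r q : R).
Hypotheses (ha : harten_parameter alpha) (r0 : 0 < r) (q0 : 0 < q).

Lemma zfac_gt0 : 0 < zfac alpha r q.
Proof. by rewrite !(mulr_gt0, powR_gt0, invr_gt0). Qed.

Lemma ln_zfac :
  ln (zfac alpha r q) =
  (alpha * ln r + (1 - alpha - g) * ln q) / (alpha + g).
Proof.
have [a0 ag0 _] := harten_parameter_neq0 ha.
rewrite /zfac !(lnM_gt0, ln_powR, lnV_gt0) ?(mulr_gt0, powR_gt0, invr_gt0) //.
by field.
Qed.

(** With theta = p / rho, [ln_zfac] shows that z_1 is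
    rho^((1-gamma)/(alpha+gamma)) theta^((1-alpha-gamma)/(alpha+gamma)), which
    can be solved for rho because gamma is not 1. *)
Lemma density_of_zfac :
  (zfac alpha r q * (q / r) `^ ((alpha + g - 1) / (alpha + g)))
    `^ ((alpha + g) / (1 - g)) = r.
Proof.
have [a0 ag0 _] := harten_parameter_neq0 ha.
have g1 : 1 - g != 0 by rewrite -opprB oppr_eq0 gammaB1_neq0.
have z0 := zfac_gt0; apply: ln_inj_gt0; first 1 last.
- by [].
- rewrite !(ln_powR, lnM_gt0, lnV_gt0, ln_zfac)
    ?(mulr_gt0, powR_gt0, invr_gt0) //.
  by field; rewrite ag0.
by rewrite !(powR_gt0, mulr_gt0, invr_gt0).
Qed.

(** The denominator of the mass flux is designed to turn z_1 V_i into rho V_i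
    when the two states agree. *)
Lemma mass_flux_zfac :
  zfac alpha r q /
    (zfac alpha r q `^ (- g / alpha) * q `^ ((1 - g - alpha) / alpha)) = r.
Proof.
have [a0 ag0 _] := harten_parameter_neq0 ha.
have z0 := zfac_gt0; apply: ln_inj_gt0; first 1 last.
- by [].
- rewrite !(ln_powR, lnM_gt0, lnV_gt0, ln_zfac)
    ?(mulr_gt0, powR_gt0, invr_gt0) //.
  by field; rewrite a0.
by rewrite !(powR_gt0, mulr_gt0, invr_gt0).
Qed.

(** Likewise for the enthalpy part of the energy flux. *)
Lemma energy_flux_zfac :
  q `^ (- (g - 1) / alpha) * zfac alpha r q `^ (- (g + alpha) / alpha) = q / r.
Proof.
have [a0 ag0 _] := harten_parameter_neq0 ha.
have z0 := zfac_gt0; apply: ln_inj_gt0; first 1 last.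
- by rewrite divr_gt0.
- rewrite !(ln_powR, lnM_gt0, lnV_gt0, ln_zfac)
    ?(mulr_gt0, powR_gt0, invr_gt0) //.
  by field; rewrite ag0 a0.
by rewrite !(powR_gt0, mulr_gt0, invr_gt0).
Qed.

End Positive.

(** The converse of [density_of_zfac]. *)
Lemma zfac_of_density alpha w th : harten_parameter alpha -> 0 < w -> 0 < th ->
  let r := (w * th `^ ((alpha + g - 1) / (alpha + g))) `^
             ((alpha + g) / (1 - g)) in
  zfac alpha r (r * th) = w.
Proof.
move=> ha w0 th0 r; have [a0 ag0 _] := harten_parameter_neq0 ha.
have g1 : 1 - g != 0 by rewrite -opprB oppr_eq0 gammaB1_neq0.
have r0 : 0 < r by rewrite !(powR_gt0, mulr_gt0).
apply: ln_inj_gt0 => //; first by rewrite zfac_gt0 ?mulr_gt0.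
rewrite ln_zfac ?mulr_gt0 // lnM_gt0 // /r.
rewrite !(ln_powR, lnM_gt0) ?(mulr_gt0, powR_gt0) //.
by field; rewrite ag0.
Qed.

End PowerIdentities.

(** * Closed forms of the entropy variables and their inverse *)

Section States.
Context {R : realType} {d : nat}.
Implicit Types (U W : 'rV[R]_d.+2) (c : 'I_d.+2) (i j : 'I_d).
Local Notation g := (gamma R).

Lemma vidxE i : vidx i = i.+1 :> nat.
Proof. by rewrite /vidx inordK // ltnS ltnW // ltnS. Qed.

Lemma vidx_neq0 i : (vidx i == ord0) = false.
Proof. by apply/negbTE; rewrite -val_eqE /= vidxE. Qed.

Lemma vidx_neqmax i : (vidx i == ord_max) = false.
Proof.
by apply/negbTE; rewrite -val_eqE /= vidxE eqSS neq_ltn ltn_ord.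
Qed.

Lemma ordmax_neq0 : ((ord_max : 'I_d.+2) == ord0) = false.
Proof. by rewrite -val_eqE. Qed.

Lemma vidx_eq i j : (vidx i == vidx j) = (i == j).
Proof. by rewrite -val_eqE /= !vidxE eqSS val_eqE. Qed.

Variant state_index_spec c : Prop :=
| StateDensity of c = ord0
| StateMomentum i of c = vidx i
| StateEnergy of c = ord_max.

Lemma state_indexP c : state_index_spec c.
Proof.
have [/eqP c0|c0] := boolP (c == ord0); first exact: StateDensity.
have [/eqP cm|cm] := boolP (c == ord_max); first exact: StateEnergy.
have lc : (c.-1 < d)%N.
  have := ltn_ord c; move: c0 cm; rewrite -!val_eqE /=.
  by case: (val c) => //= m _ md; rewrite ltnS leq_eqVlt (negbTE md).
apply: (@StateMomentum _ (Ordinal lc)); apply/val_inj; rewrite /= vidxE /=.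
by rewrite prednK // lt0n; move: c0; rewrite -val_eqE.
Qed.

Definition kinetic U : R := \sum_(j < d) velocity U j ^+ 2.

Definition entropy_var_closed alpha U : 'rV[R]_d.+2 :=
  \row_c (zfac alpha (density U) (pressure U) *
    (if c == ord0 then
       - (alpha / (g - 1) * (pressure U / density U)) - 2%:R^-1 * kinetic U
     else if c == ord_max then -1 else U 0 c / density U)).

Lemma has_partial_velocity U c j : density U != 0 ->
  has_partial (fun V => velocity V j) U c
    (((c == vidx j)%:R - (c == ord0)%:R * velocity U j) / density U).
Proof.
move=> r0; have hr : has_partial (@density R d) U c (c == ord0)%:R.
  exact: has_partial_coord.
have := has_partialM (has_partial_coord (vidx j) U c) (has_partialV r0 hr).
by move/has_partial_eq; apply; rewrite /velocity; field.
Qed.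

(** dp = (gamma - 1) (de - V . d(rho V) + |V|^2/2 drho) *)
Lemma has_partial_pressure U c : density U != 0 ->
  has_partial (@pressure R d) U c
    ((g - 1) * ((c == ord_max)%:R -
                \sum_(j < d) (c == vidx j)%:R * velocity U j +
                2%:R^-1 * (c == ord0)%:R * kinetic U)).
Proof.
move=> r0; have hr : has_partial (@density R d) U c (c == ord0)%:R.
  exact: has_partial_coord.
have he : has_partial (@energy R d) U c (c == ord_max)%:R.
  exact: has_partial_coord.
have hk := @has_partial_sum _ _ d (fun j V => velocity V j * velocity V j)
  _ U c (fun j => has_partialM (has_partial_velocity c j r0)
                               (has_partial_velocity c j r0)).
have hs := has_partialM (has_partialM (has_partial_cst 2%:R^-1 U c) hr) hk.
have := has_partialM (has_partial_cst (g - 1) U c)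
  (has_partialD he (has_partialM (has_partial_cst (-1) U c) hs)).
have kinE V : \sum_j velocity V j * velocity V j = kinetic V.
  by apply: eq_bigr => j _; rewrite expr2.
have -> : (fun V => (g - 1) * (energy V + -1 * (2%:R^-1 * density V *
    \sum_j velocity V j * velocity V j))) = @pressure R d.
  by apply/funext => V; rewrite kinE mulN1r.
move/has_partial_eq; apply; rewrite kinE.
set K := kinetic U; set S := \sum_j _ * velocity U j.
have -> : \sum_i (((c == vidx i)%:R - (c == ord0)%:R * velocity U i) /
    density U * velocity U i + velocity U i *
    (((c == vidx i)%:R - (c == ord0)%:R * velocity U i) / density U)) =
  2 * (S - (c == ord0)%:R * K) / density U.
  rewrite /S /K /kinetic mulr_sumr -sumrB mulr_sumr mulr_suml.
  by apply: eq_bigr => j _; field.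
by field.
Qed.

(** Differentiating the logarithm of Q = (p rho^-gamma)^(1/(alpha+gamma)) gives
    dS = beta Q drho + beta rho Q (dp/p - gamma drho/rho) / (alpha+gamma), and
    beta / (alpha+gamma) = -1 / (gamma-1) yields the stated coefficients. *)
Lemma entropy_varE alpha U : harten_parameter alpha -> admissible U ->
  entropy_var alpha U = entropy_var_closed alpha U.
Proof.
move=> ha [r0 p0]; have rn0 : density U != 0 by rewrite gt_eqF.
have pn0 : pressure U != 0 by rewrite gt_eqF.
have [a0 ag0 _] := harten_parameter_neq0 ha.
have gn0 := @gammaB1_neq0 R.
have Yp s : 0 < density U `^ s by rewrite powR_gt0.
have Xp : 0 < pressure U * density U `^ (- g) by rewrite mulr_gt0.
apply/rowP => c; rewrite !mxE.
have hr : has_partial (@density R d) U c (c == ord0)%:R.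
  exact: has_partial_coord.
have hp := has_partial_pressure c rn0.
have hX := has_partial_powR (alpha + g)^-1 Xp
  (has_partialM hp (has_partial_powR (- g) r0 hr)).
have [_] := has_partialM (has_partialM (has_partial_cst (beta alpha) U c) hr) hX.
rewrite /harten_entropy => ->.
rewrite /zfac powRB ?powRr1 ?(ltW Xp) //; last first.
  by rewrite (gt_eqF Xp) implybT.
rewrite powRB ?powRr1 ?(ltW r0) //; last by rewrite rn0 implybT.
set Y := density U `^ (- g) in Xp *.
have Yn0 : Y != 0 by rewrite gt_eqF // Yp.
set Q := _ `^ (alpha + g)^-1; set K := kinetic U.
have -> : \sum_(j < d) (c == vidx j)%:R * velocity U j =
          (~~ ((c == ord0) || (c == ord_max)))%:R * (U 0 c / density U).
  case: (state_indexP c) => [->|i ->|->].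
  - rewrite eqxx mul0r big1 // => j _.
    by rewrite eq_sym vidx_neq0 mul0r.
  - rewrite vidx_neq0 vidx_neqmax mul1r (bigD1 i) //= eqxx mul1r big1 ?addr0 //.
    by move=> j ji; rewrite vidx_eq eq_sym (negbTE ji) mul0r.
  - rewrite eqxx orbT mul0r big1 // => j _.
    by rewrite eq_sym vidx_neqmax mul0r.
rewrite /beta.
case: (state_indexP c) => [->|i ->|->].
- rewrite eqxx eq_sym ordmax_neq0 /=; field.
  by rewrite rn0 pn0 gn0 ag0 Yn0.
- rewrite vidx_neq0 vidx_neqmax /=; field.
  by rewrite rn0 pn0 gn0 ag0 Yn0.
- rewrite eqxx ordmax_neq0 /=; field.
  by rewrite rn0 pn0 gn0 ag0 Yn0.
Qed.

(** The temperature p / rho as a function of the entropy variables. The last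
    one is minus [zfac], the velocity is minus the quotient of the middle ones
    by it, and W_0 / W_max = alpha / (gamma-1) p / rho + |V|^2 / 2. *)
Definition theta_of alpha W : R :=
  (g - 1) / alpha * (W 0 ord0 / W 0 ord_max -
    2%:R^-1 * \sum_(j < d) (W 0 (vidx j) / W 0 ord_max) ^+ 2).

Definition density_of alpha W : R :=
  (- W 0 ord_max * theta_of alpha W `^ ((alpha + g - 1) / (alpha + g))) `^
    ((alpha + g) / (1 - g)).

Definition state_of alpha W : 'rV[R]_d.+2 :=
  \row_c (density_of alpha W *
    (if c == ord0 then 1
     else if c == ord_max then
       theta_of alpha W / (g - 1) +
       2%:R^-1 * \sum_(j < d) (W 0 (vidx j) / W 0 ord_max) ^+ 2
     else - (W 0 c / W 0 ord_max))).

(** The image of the admissible states, described by open conditions. *)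
Definition entropy_domain alpha : set 'rV[R]_d.+2 :=
  [set W : 'rV[R]_d.+2 | W 0 ord_max < 0 /\ 0 < theta_of alpha W].

Lemma entropy_var_closed_lt0 alpha U : admissible U ->
  entropy_var_closed alpha U 0 ord_max < 0.
Proof.
move=> [r0 p0]; rewrite !mxE ordmax_neq0 eqxx mulrN1 oppr_lt0.
exact: zfac_gt0.
Qed.

Lemma theta_ofE alpha U : harten_parameter alpha -> admissible U ->
  theta_of alpha (entropy_var_closed alpha U) = pressure U / density U.
Proof.
move=> ha [r0 p0]; have [a0 _ _] := harten_parameter_neq0 ha.
have z0 := zfac_gt0 alpha r0 p0.
have zn0 : zfac alpha (density U) (pressure U) != 0 by rewrite gt_eqF.
rewrite /theta_of !mxE eqxx ordmax_neq0 eqxx.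
under eq_bigr => j _.
  rewrite !mxE vidx_neq0 vidx_neqmax mulrN1 invrN mulrN sqrrN.
  rewrite (mulrC (zfac _ _ _)) mulfK //; over.
rewrite -/(kinetic U); field.
by rewrite gt_eqF // zn0 a0 gammaB1_neq0.
Qed.

Lemma state_ofK alpha U : harten_parameter alpha -> admissible U ->
  state_of alpha (entropy_var_closed alpha U) = U.
Proof.
move=> ha aU; have [r0 p0] := aU; have [a0 ag0 _] := harten_parameter_neq0 ha.
have z0 := zfac_gt0 alpha r0 p0.
have zn0 : zfac alpha (density U) (pressure U) != 0 by rewrite gt_eqF.
have rn0 : density U != 0 by rewrite gt_eqF.
have gn0 := @gammaB1_neq0 R.
have rE : density_of alpha (entropy_var_closed alpha U) = density U.
  rewrite /density_of theta_ofE // !mxE ordmax_neq0 eqxx mulrN1 opprK.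
  exact: density_of_zfac.
apply/rowP => c; rewrite !mxE rE theta_ofE //.
under eq_bigr => j _.
  rewrite !mxE vidx_neq0 ordmax_neq0 eqxx vidx_neqmax mulrN1 invrN mulrN sqrrN.
  rewrite (mulrC (zfac _ _ _)) mulfK //; over.
rewrite -/(kinetic U) ordmax_neq0 eqxx.
case: (state_indexP c) => [->|i ->|->].
- by rewrite eqxx mulr1.
- rewrite vidx_neq0 vidx_neqmax; field.
  by rewrite zn0.
- rewrite ordmax_neq0 eqxx /pressure -/(kinetic U) /energy; field.
  by rewrite rn0 gn0.
Qed.

Section OnDomain.
Variables (alpha : R) (W : 'rV[R]_d.+2).
Hypotheses (ha : harten_parameter alpha) (DW : entropy_domain alpha W).

Lemma density_of_gt0 : 0 < density_of alpha W.
Proof.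
by have [w0 th0] := DW; rewrite powR_gt0 // mulr_gt0 ?powR_gt0 ?oppr_gt0.
Qed.

Lemma density_state_of : density (state_of alpha W) = density_of alpha W.
Proof. by rewrite /density mxE eqxx mulr1. Qed.

Lemma velocity_state_of j :
  velocity (state_of alpha W) j = - (W 0 (vidx j) / W 0 ord_max).
Proof.
have r0 := density_of_gt0.
rewrite /velocity density_state_of mxE vidx_neq0 vidx_neqmax mulrC mulKf //.
by rewrite gt_eqF.
Qed.

Lemma pressure_state_of :
  pressure (state_of alpha W) = density_of alpha W * theta_of alpha W.
Proof.
have kE : \sum_(j < d) velocity (state_of alpha W) j ^+ 2 =
    \sum_(j < d) (W 0 (vidx j) / W 0 ord_max) ^+ 2.
  by apply: eq_bigr => j _; rewrite velocity_state_of sqrrN.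
rewrite /pressure kE density_state_of /energy mxE ordmax_neq0 eqxx.
by field; exact: gammaB1_neq0.
Qed.

Lemma admissible_state_of : admissible (state_of alpha W).
Proof.
have [_ th0] := DW; rewrite /admissible density_state_of pressure_state_of.
by rewrite mulr_gt0 ?density_of_gt0.
Qed.

Lemma entropy_var_state_of : entropy_var_closed alpha (state_of alpha W) = W.
Proof.
have [w0 th0] := DW; have r0 := density_of_gt0.
have [a0 _ _] := harten_parameter_neq0 ha.
have wn0 : W 0 ord_max != 0 by rewrite lt_eqF.
have rn0 : density_of alpha W != 0 by rewrite gt_eqF.
have wm0 : 0 < - W 0 ord_max by rewrite oppr_gt0.
apply/rowP => c; rewrite [LHS]mxE density_state_of pressure_state_of.
rewrite (zfac_of_density ha wm0 th0).
case: (state_indexP c) => [->|i ->|->].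
- rewrite eqxx /kinetic; under eq_bigr do rewrite velocity_state_of sqrrN.
  rewrite /theta_of; field.
  by rewrite wn0 rn0 a0 gammaB1_neq0.
- rewrite vidx_neq0 vidx_neqmax -density_state_of -/(velocity _ i).
  by rewrite velocity_state_of; field.
- by rewrite ordmax_neq0 eqxx mulrN1 opprK.
Qed.

End OnDomain.

Lemma entropy_var_domain alpha U : harten_parameter alpha -> admissible U ->
  entropy_domain alpha (entropy_var_closed alpha U).
Proof.
move=> ha aU; split; first exact: entropy_var_closed_lt0.
by rewrite theta_ofE //; case: aU => r0 p0; rewrite divr_gt0.
Qed.

(** The inverse picked by choice is the explicit one, since the entropy
    variables are injective on admissible states by [state_ofK]. *)
Lemma conservative_ofE alpha W : harten_parameter alpha ->
  entropy_domain alpha W -> conservative_of alpha W = state_of alpha W.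
Proof.
move=> ha DW; have aW := admissible_state_of DW.
rewrite /conservative_of; case: xgetP => [U _ [aU UW]|/(_ (state_of alpha W))[]].
  by rewrite -UW entropy_varE // state_ofK.
by split=> //; rewrite entropy_varE // entropy_var_state_of.
Qed.

End States.

(** * Smoothness of the fluxes and of the entropy variables *)

Section SmoothStates.
Context {R : realType} {n d : nat}.
Variables (k : nat) (D : set 'rV[R]_n) (V : 'rV[R]_n -> 'rV[R]_d.+2).
Hypotheses (smV : forall c, Ck_on k D (fun y => V y 0 c))
           (aV : forall y, D y -> admissible (V y)).
Local Notation g := (gamma R).

Lemma Ck_on_density : Ck_on k D (fun y => density (V y)).
Proof. exact: smV. Qed.

Lemma Ck_on_densityV : Ck_on k D (fun y => (density (V y))^-1).
Proof.
apply: Ck_onV; last exact: Ck_on_density.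
by move=> y /aV[r0 _]; rewrite gt_eqF.
Qed.

Lemma Ck_on_velocity i : Ck_on k D (fun y => velocity (V y) i).
Proof. by apply: Ck_onM; [exact: smV|exact: Ck_on_densityV]. Qed.

Lemma Ck_on_kinetic : Ck_on k D (fun y => kinetic (V y)).
Proof. by apply: Ck_on_sum => j; apply: Ck_onX; exact: Ck_on_velocity. Qed.

Lemma Ck_on_pressure : Ck_on k D (fun y => pressure (V y)).
Proof.
apply: Ck_onM; first exact: Ck_on_cst.
apply: Ck_onB; first exact: smV.
apply: Ck_onM; last exact: Ck_on_kinetic.
by apply: Ck_onM; [exact: Ck_on_cst|exact: Ck_on_density].
Qed.

Lemma Ck_on_flux i c : Ck_on k D (fun y => flux i (V y) 0 c).
Proof.
under eq_fun do rewrite mxE; case: (c == ord0).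
  by apply: Ck_onM; [exact: Ck_on_density|exact: Ck_on_velocity].
case: (c == ord_max).
  apply: Ck_onM; last exact: Ck_on_velocity.
  by apply: Ck_onD; [exact: smV|exact: Ck_on_pressure].
apply: Ck_onD; apply: Ck_onM; first exact: smV; first exact: Ck_on_velocity.
  exact: Ck_on_cst.
exact: Ck_on_pressure.
Qed.

Lemma Ck_on_entropy_var_closed alpha c :
  Ck_on k D (fun y => entropy_var_closed alpha (V y) 0 c).
Proof.
under eq_fun do rewrite mxE; apply: Ck_onM.
  apply: Ck_onM; first apply: Ck_onM; first exact: Ck_on_density.
    apply: Ck_onV; last exact: Ck_on_pressure.
    by move=> y /aV[_ p0]; rewrite gt_eqF.
  apply: Ck_on_powR; first by move=> y /aV[r0 p0]; rewrite mulr_gt0 ?powR_gt0.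
  apply: Ck_onM; first exact: Ck_on_pressure.
  by apply: Ck_on_powR => [y /aV[]//|]; exact: Ck_on_density.
case: (c == ord0); last case: (c == ord_max); last first.
- by apply: Ck_onM; [exact: smV|exact: Ck_on_densityV].
- exact: Ck_on_cst.
apply: Ck_onB; last first.
  by apply: Ck_onM; [exact: Ck_on_cst|exact: Ck_on_kinetic].
apply: Ck_onN; apply: Ck_onM; first exact: Ck_on_cst.
by apply: Ck_onM; [exact: Ck_on_pressure|exact: Ck_on_densityV].
Qed.

End SmoothStates.

Section SmoothInverse.
Context {R : realType} {d : nat}.
Variables (alpha : R).
Hypothesis ha : harten_parameter alpha.

Lemma Ck_on_theta_of k (D : set 'rV[R]_d.+2) :
  (forall W, D W -> W 0 ord_max != 0) -> Ck_on k D (theta_of alpha).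
Proof.
move=> w0; have ratio c : Ck_on k D (fun W => W 0 c / W 0 ord_max).
  by apply: Ck_onM; [|apply: Ck_onV => //]; exact: Ck_on_coord.
apply: Ck_onM; first exact: Ck_on_cst.
apply: Ck_onB; first exact: ratio.
apply: Ck_onM; first exact: Ck_on_cst.
by apply: Ck_on_sum => j; apply: Ck_onX; exact: ratio.
Qed.

Lemma Ck_on_state_of k c :
  Ck_on k (entropy_domain alpha) (fun W => @state_of R d alpha W 0 c).
Proof.
have w0 (W : 'rV[R]_d.+2) : entropy_domain alpha W -> W 0 ord_max != 0.
  by move=> [wn0 _]; rewrite lt_eqF.
have ratio b : Ck_on k (entropy_domain alpha)
    (fun W : 'rV[R]_d.+2 => W 0 b / W 0 ord_max).
  by apply: Ck_onM; [|apply: Ck_onV => //]; exact: Ck_on_coord.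
under eq_fun do rewrite mxE; apply: Ck_onM.
  apply: Ck_on_powR.
    by move=> W [wn0 t0]; rewrite mulr_gt0 ?powR_gt0 // oppr_gt0.
  apply: Ck_onM; first by apply: Ck_onN; exact: Ck_on_coord.
  by apply: Ck_on_powR => [W []//|]; exact: Ck_on_theta_of.
case: (c == ord0); last case: (c == ord_max).
- exact: Ck_on_cst.
- apply: Ck_onD; apply: Ck_onM; [exact: Ck_on_theta_of|exact: Ck_on_cst..|].
  by apply: Ck_on_sum => j; apply: Ck_onX; exact: ratio.
- by apply: Ck_onN; exact: ratio.
Qed.

Lemma open_entropy_domain : open (@entropy_domain R d alpha).
Proof.
pose D0 : set 'rV[R]_d.+2 := [set W | setT W /\ 0 < - W 0 ord_max].
have oD0 : open D0.
  apply: open_gt0; first exact: openT.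
  by apply: Ck_onN; exact: Ck_on_coord.
have -> : @entropy_domain R d alpha = [set W | D0 W /\ 0 < theta_of alpha W].
  apply/seteqP; split=> W /=; rewrite /entropy_domain /D0 /= oppr_gt0.
    by case.
  by case=> -[].
apply: open_gt0 => //; apply: Ck_on_theta_of => W [_].
by rewrite oppr_gt0 => wn0; rewrite lt_eqF.
Qed.

(** The choice-based inverse and the explicit one agree on a whole
    neighbourhood of W(U), hence have the same derivatives there. *)
Lemma AtildeE i (U : 'rV[R]_d.+2) a b : admissible U ->
  Atilde alpha i U a b =
  partial (fun W => flux i (state_of alpha W) 0 a) b
    (entropy_var_closed alpha U).
Proof.
move=> aU; rewrite mxE entropy_varE //; apply: near_eq_derive.
have : nbhs (entropy_var_closed alpha U) (entropy_domain alpha).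
  apply: open_nbhs_nbhs; split; first exact: open_entropy_domain.
  exact: entropy_var_domain.
by apply: filterS => W DW; rewrite conservative_ofE.
Qed.

Lemma Ck_on_flux_state_of k i a :
  Ck_on k (entropy_domain alpha)
    (fun W : 'rV[R]_d.+2 => flux i (state_of alpha W) 0 a).
Proof.
apply: Ck_on_flux => [c|W DW]; first exact: Ck_on_state_of.
exact: admissible_state_of.
Qed.

Section AlongField.
Variables (m : nat) (V : 'rV[R]_m -> 'rV[R]_d.+2).
Hypotheses (aV : forall y, admissible (V y))
           (smV : forall c, Ck_on 1 setT (fun y => V y 0 c)).

Let w y := entropy_var_closed alpha (V y).

Let differentiable_w x c : differentiable (fun y => w y 0 c) x.
Proof.
by have [+ _] := Ck_on_entropy_var_closed smV (fun y _ => aV y) alpha c; apply.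
Qed.

(** The flux along V is the composition of W |-> F(U(W)) with y |-> W(V y):
    the chain rule turns A W_x into F_x. *)
Lemma Atilde_chain i j a x :
  partial (fun y => flux i (V y) 0 a) j x =
  \sum_b Atilde alpha i (V x) a b *
         partial (fun y => entropy_var alpha (V y) 0 b) j x.
Proof.
have [dG _] := Ck_on_flux_state_of 1 i a.
have [_] := has_partial_chain j (differentiable_w x)
  (dG _ (entropy_var_domain ha (aV x))).
have -> : (fun y => flux i (state_of alpha (w y)) 0 a) =
          (fun y => flux i (V y) 0 a).
  by apply/funext => y; rewrite /w state_ofK.
move=> ->; apply: eq_bigr => b _.
have wE : (fun y => w y 0 b) = (fun y => entropy_var alpha (V y) 0 b).
  by apply/funext => y; rewrite entropy_varE.
by rewrite wE AtildeE.
Qed.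

Lemma continuous_Atilde i a b : continuous (fun x => Atilde alpha i (V x) a b).
Proof.
have [dG [pG hG]] := Ck_on_flux_state_of 1 i a.
have [pGE cG] := hG b.
have -> : (fun x => Atilde alpha i (V x) a b) = pG b \o w.
  apply/funext => x; rewrite AtildeE //=.
  by have [_ ->] := pGE _ (entropy_var_domain ha (aV x)).
move=> x; apply: continuous_comp; last exact/cG/entropy_var_domain.
exact/differentiable_continuous/differentiable_row.
Qed.

End AlongField.
End SmoothInverse.

(** * Consistency of the two-point flux *)

Lemma avgxx {R : realType} (a : R) : avg a a = a.
Proof. by rewrite /avg; field. Qed.

Lemma eavgxx {R : realType} (s a : R) : eavg s a a = a `^ s.
Proof. by rewrite /eavg eqxx. Qed.

Lemma two_point_flux_consistent {R : realType} {d : nat} (alpha : R) (i : 'I_d)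
    (U : 'rV[R]_d.+2) : harten_parameter alpha -> admissible U ->
  two_point_flux alpha i U U = flux i U.
Proof.
move=> ha [r0 p0]; have rn0 : density U != 0 by rewrite gt_eqF.
have gn0 := @gammaB1_neq0 R.
have z0 : zvec alpha U 0 ord0 = zfac alpha (density U) (pressure U).
  by rewrite mxE.
have zv j : zvec alpha U 0 (vidx j) = velocity U j.
  by rewrite mxE vidx_neq0 vidx_neqmax.
have zm : zvec alpha U 0 ord_max = pressure U by rewrite mxE ordmax_neq0 eqxx.
apply/rowP => c; rewrite [LHS]mxE [RHS]mxE; cbv beta zeta.
rewrite z0 zv zm !avgxx !eavgxx.
rewrite -mulrA (mulrC (velocity U i)) mulrA mass_flux_zfac //.
case: (state_indexP c) => [->|j ->|->].
- by [].
- rewrite vidx_neq0 vidx_neqmax zv vidx_eq /velocity; field.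
  by rewrite rn0.
- rewrite ordmax_neq0 eqxx -(mulrA (gamma R / _)) energy_flux_zfac //.
  have -> : \sum_(j < d)
      avg (zvec alpha U 0 (vidx j)) (zvec alpha U 0 (vidx j)) ^+ 2 = kinetic U.
    by apply: eq_bigr => j _; rewrite avgxx zv.
  have -> : \sum_(j < d) zvec alpha U 0 (vidx j) ^+ 2 = kinetic U.
    by apply: eq_bigr => j _; rewrite zv.
  rewrite /pressure /energy -/(kinetic U); field.
  by rewrite rn0 gn0.
Qed.

(** * Periodic functions are bounded *)

(** Reducing the lattice coordinates modulo 1 brings every point into the
    compact period cell. *)
Lemma periodic_bounded {R : realType} {d : nat} (L : 'M[R]_d)
    (f : 'rV[R]_d -> R) : L \in unitmx -> Defs.periodic L f -> continuous f ->
  exists C, forall x, `|f x| <= C.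
Proof.
move=> uL pf cf.
pose K := [set v : 'rV[R]_d | forall i, `[(0 : R), 1]%classic (v ord0 i)].
have cK : compact K.
  by apply: (@rV_compact _ _ (fun=> `[(0 : R), 1]%classic)) => i;
     exact: segment_compact.
have cL : continuous (fun v : 'rV[R]_d => v *m L).
  move=> v; apply/differentiable_continuous/differentiable_row => b.
  suff [+ _] : Ck_on 1 setT (fun y : 'rV[R]_d => (y *m L) 0 b) by apply.
  under eq_fun do rewrite mxE.
  apply: Ck_on_sum => j; apply: Ck_onM; first exact: Ck_on_coord.
  exact: Ck_on_cst.
have cfL : continuous (fun v : 'rV[R]_d => f (v *m L)).
  by move=> v; exact: (continuous_comp (cL v) (cf (v *m L))).
have cI : compact ((fun v => f (v *m L)) @` K).
  by apply: continuous_compact => //; exact: continuous_subspaceT.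
have [N [_ NP]] := compact_bounded cI.
exists (N + 1) => x; pose y := x *m invmx L.
pose z : 'rV[int]_d := \row_i Num.floor (y 0 i).
pose v : 'rV[R]_d := \row_i (y 0 i - (Num.floor (y 0 i))%:~R).
have -> : x = v *m L + lat L z.
  rewrite /lat -mulmxDl -[x in LHS](mulmxKV uL) -/y; congr (_ *m _).
  by apply/rowP => i; rewrite !mxE subrK.
rewrite pf; apply: (NP (N + 1)); first by rewrite ltrDl.
exists v => // i /=; rewrite in_itv /= mxE subr_ge0 floor_le_tmp /=.
by rewrite lerBlDr addrC -[X in _ + X]/(1%:~R) -intrD ltW // floorD1_gt.
Qed.

(** * Kronecker products acting on stacked nodal values *)

Section Stacked.
Context {R : realType} {np d : nat}.

Lemma sum_mxtens n (F : 'I_(np * n) -> R) :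
  \sum_a F a = \sum_m \sum_c F (mxtens_index (m, c)).
Proof.
rewrite pair_bigA /=; apply: reindex.
exists (@mxtens_unindex np n) => [[m c] _|a _]; first by rewrite mxtens_indexK.
by rewrite -[RHS]mxtens_unindexK.
Qed.

Lemma stackE n (f : 'I_np -> 'rV[R]_n) m c :
  stack f (mxtens_index (m, c)) 0 = f m 0 c.
Proof. by rewrite mxE mxtens_indexK. Qed.

(* The two components of [mxtens_unindex], in the form to which a pattern match
   on it reduces. *)
Lemma unindex1 n (m : 'I_np) (c : 'I_n) :
  Ordinal (mxtens_index_proof1 (mxtens_index (m, c))) = m.
Proof. exact: (congr1 fst (mxtens_indexK (m, c))). Qed.

Lemma unindex2 n (m : 'I_np) (c : 'I_n) :
  Ordinal (mxtens_index_proof2 (mxtens_index (m, c))) = c.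
Proof. exact: (congr1 snd (mxtens_indexK (m, c))). Qed.

Lemma overbar_mulE (A : 'M[R]_np) (x : 'cV[R]_(np * d.+2)) m c :
  (overbar d A *m x) (mxtens_index (m, c)) 0 =
  \sum_n A m n * x (mxtens_index (n, c)) 0.
Proof.
rewrite mxE sum_mxtens; apply: eq_bigr => n _.
rewrite (bigD1 c) //= tensmxE mxE eqxx mulr1 big1 ?addr0 // => c' c'c.
by rewrite tensmxE mxE eq_sym (negbTE c'c) mulr0 mul0r.
Qed.

Lemma block_diag_mulE n (A : 'I_np -> 'M[R]_n) (x : 'cV[R]_(np * n)) m c :
  (block_diag A *m x) (mxtens_index (m, c)) 0 =
  \sum_b A m c b * x (mxtens_index (m, b)) 0.
Proof.
rewrite mxE sum_mxtens (bigD1 m) //= [X in _ + X]big1 ?addr0 => [|l lm].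
  by apply: eq_bigr => b _; rewrite mxE !mxtens_indexK eqxx.
by apply: big1 => b _; rewrite mxE !mxtens_indexK eq_sym (negbTE lm) mul0r.
Qed.

Lemma hadamard_flux_mulE alpha i (A : 'M[R]_np) (u v : 'I_np -> 'rV[R]_d.+2)
    m c :
  (hadamard (overbar d A) (Fmx alpha i u v) *m
     (const_mx 1 : 'cV[R]_(np * d.+2))) (mxtens_index (m, c)) 0 =
  2%:R * \sum_n A m n * two_point_flux alpha i (u m) (v n) 0 c.
Proof.
rewrite /Fmx; move: (two_point_flux alpha i) => F.
rewrite mxE sum_mxtens mulr_sumr; apply: eq_bigr => n _.
rewrite (bigD1 c) //= [X in _ + X]big1 ?addr0 => [|c' c'c].
  by rewrite !mxE !mxtens_indexK /= !(unindex1, unindex2) !eqxx !mulr1 mulrCA.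
by rewrite !mxE !(unindex1, unindex2) [c == c']eq_sym (negbTE c'c) mulr0 mul0r.
Qed.

End Stacked.

(** * The penalty term vanishes on smooth periodic states *)

Section Penalty.
Context {R : realType} {d p np nf nfac : nat} (alpha : R) (L : 'M[R]_d).
Context (E : ref_element R d nfac) (M : mesh R d np nf nfac).
Hypotheses (ha : harten_parameter alpha) (hnodes : are_nodes L E M)
           (hSBP : is_SBP p E M).
Variable V : 'rV[R]_d -> 'rV[R]_d.+2.
Hypotheses (pV : Defs.periodic L V) (aV : forall x, admissible (V x)).

Let facet_weight i (k : 'I_(nelt M)) fc j : R :=
  Bmx k fc j j * normal E k fc (fpar k fc j) 0 i.

Lemma facet_mx_sum i (k : 'I_(nelt M)) fc (S : 'M[R]_(nf, np))
    (y : 'I_np -> R) m :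
  \sum_n ((Rmx k fc)^T *m Bmx k fc *m Nmx E i k fc *m S) m n * y n =
  \sum_j (m == fnode k fc j)%:R * facet_weight i k fc j * \sum_n S j n * y n.
Proof.
have wE j : ((Rmx k fc)^T *m Bmx k fc *m Nmx E i k fc) m j =
    (m == fnode k fc j)%:R * facet_weight i k fc j.
  rewrite /Nmx mul_mx_diag [LHS]mxE [X in X * _]mxE [X in _ * X]mxE.
  rewrite (bigD1 j) //= big1 ?addr0 => [|l lj].
    by rewrite [X in X * Bmx _ _ _ _]mxE [X in X * Bmx _ _ _ _]mxE -mulrA.
  by have /is_diag_mxP -> := B_diag hSBP k fc; rewrite ?mulr0.
under eq_bigr do rewrite mxE mulr_suml.
rewrite exchange_big; apply: eq_bigr => j _ /=.
by rewrite mulr_sumr; apply: eq_bigr => n _; rewrite wE !mulrA.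
Qed.

(** Both sides see the state at the same physical point: a facet node and its
    copy in the neighbour differ by a period. *)
Lemma facet_flux_match i (k : 'I_(nelt M)) fc m c :
  \sum_n Ekv E i k fc m n *
    two_point_flux alpha i (nodal M V k m) (nodal M V (nbr k fc).1 n) 0 c =
  \sum_n Ekk E i k fc m n * flux i (nodal M V k n) 0 c.
Proof.
have selE k' fc' j (y : 'I_np -> R) :
    \sum_n Rmx k' fc' j n * y n = y (@fnode R d np nf nfac M k' fc' j).
  rewrite (bigD1 (fnode k' fc' j)) //= mxE eqxx mul1r big1 ?addr0 // => n nj.
  by rewrite mxE (negbTE nj) mul0r.
rewrite !facet_mx_sum; apply: eq_bigr => j _; rewrite !selE.
have [->|_] := eqVneq m (fnode k fc j); last by rewrite !mul0r.
rewrite /nodal (fnode_shared hnodes k fc j) pV.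
by rewrite two_point_flux_consistent.
Qed.

(** By [facet_flux_match] the coupling terms add up to twice the boundary terms
    of the element itself, and the factor 1/2 makes the difference vanish
    exactly. *)
Lemma SAT_eq0 k : SAT alpha E (nodal M V) k = 0.
Proof.
rewrite /SAT scalemxAr -mulmxBr.
set Z := \sum_fc \sum_i _; set Y := \sum_i _.
suff -> : Y = 2%:R^-1 *: Z by rewrite subrr mulmx0.
apply/colP => a; case: (mxtens_indexP a) => m c.
rewrite [RHS]mxE !summxE.
under [in RHS]eq_bigr => fc _.
  rewrite summxE; under eq_bigr do rewrite hadamard_flux_mulE facet_flux_match.
  rewrite -mulr_sumr; over.
rewrite -mulr_sumr mulKf ?pnatr_eq0 // exchange_big.
apply: eq_bigr => i _; rewrite overbar_mulE exchange_big.
apply: eq_bigr => n _; rewrite stackE summxE mulr_suml.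
by [].
Qed.

End Penalty.

(** * Truncation error *)

Section VolumeError.
Context {R : realType} {d np nf nfac : nat} (alpha : R).
Context (E : ref_element R d nfac) (M : mesh R d np nf nfac).
Hypothesis ha : harten_parameter alpha.
Variable V : 'rV[R]_d -> 'rV[R]_d.+2.
Hypotheses (aV : forall x, admissible (V x))
           (smV : forall c, Ck_on 1 setT (fun y => V y 0 c)).

Definition operator_error (k : 'I_(nelt M)) (i : 'I_d) (f : 'rV[R]_d -> R) :
    'cV[R]_np :=
  Dmx E i k *m restr k f - restr k (partial f i).

(** Both halves of the split form discretize the same divergence, the second one
    by [Atilde_chain], and their weights beta / (beta+1) and 1 / (beta+1) add up
    to 1. *)
Lemma volume_error k m c :
  volume_terms alpha E (nodal M V) k (mxtens_index (m, c)) 0 -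
    div_flux V (node k m) 0 c =
  beta alpha / (beta alpha + 1) *
    \sum_i operator_error k i (fun y => flux i (V y) 0 c) m 0 +
  (beta alpha + 1)^-1 *
    \sum_i \sum_b Atilde alpha i (V (node k m)) c b *
      operator_error k i (fun y => entropy_var alpha (V y) 0 b) m 0.
Proof.
have b1 : beta alpha + 1 != 0.
  have [_ _ a1] := harten_parameter_neq0 ha.
  have -> : beta alpha + 1 = - (alpha + 1) / (gamma R - 1).
    by rewrite /beta; field; exact: gammaB1_neq0.
  by rewrite mulf_neq0 ?oppr_eq0 ?invr_eq0 // gammaB1_neq0.
have errE i f : operator_error k i f m 0 =
    \sum_n Dmx E i k m n * f (node k n) - partial f i (node k m).
  rewrite [LHS]mxE [X in X + _]mxE [X in _ + X]mxE [X in - X]mxE.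
  by under eq_bigr => n _ do rewrite [X in _ * X]mxE.
have divE : div_flux V (node k m) 0 c =
    \sum_i partial (fun y => flux i (V y) 0 c) i (node k m) by rewrite mxE.
have divE' : div_flux V (node k m) 0 c = \sum_i \sum_b
    Atilde alpha i (V (node k m)) c b *
    partial (fun y => entropy_var alpha (V y) 0 b) i (node k m).
  by rewrite divE; apply: eq_bigr => i _; exact: Atilde_chain.
have fE : \sum_i operator_error k i (fun y => flux i (V y) 0 c) m 0 =
    \sum_i \sum_n Dmx E i k m n * flux i (V (node k n)) 0 c -
    div_flux V (node k m) 0 c.
  by rewrite divE -sumrB; apply: eq_bigr => i _; rewrite errE.
have wE : \sum_i \sum_b Atilde alpha i (V (node k m)) c b *
      operator_error k i (fun y => entropy_var alpha (V y) 0 b) m 0 =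
    \sum_i \sum_b Atilde alpha i (V (node k m)) c b *
      (\sum_n Dmx E i k m n * entropy_var alpha (V (node k n)) 0 b) -
    div_flux V (node k m) 0 c.
  rewrite divE' -sumrB; apply: eq_bigr => i _; rewrite -sumrB.
  by apply: eq_bigr => b _; rewrite errE mulrBr.
have -> : volume_terms alpha E (nodal M V) k (mxtens_index (m, c)) 0 =
    beta alpha / (beta alpha + 1) *
      (\sum_i \sum_n Dmx E i k m n * flux i (V (node k n)) 0 c) +
    (beta alpha + 1)^-1 *
      \sum_i \sum_b Atilde alpha i (V (node k m)) c b *
        (\sum_n Dmx E i k m n * entropy_var alpha (V (node k n)) 0 b).
  rewrite [LHS]mxE [X in X + _]mxE [X in _ + X]mxE !summxE.
  congr (_ * _ + _ * _); apply: eq_bigr => i _.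
    by rewrite overbar_mulE; apply: eq_bigr => n _; rewrite stackE.
  rewrite block_diag_mulE; apply: eq_bigr => b _; rewrite overbar_mulE.
  by congr (_ * _); apply: eq_bigr => n _; rewrite stackE.
rewrite fE wE.
by field.
Qed.

End VolumeError.

Section Order.
Context {R : realType} {X : Type} (h : X -> R) (p : nat).
Implicit Types (e f : X -> R).

Definition order_h e : Prop := exists C delta : R,
  0 < delta /\ forall x, h x < delta -> `|e x| <= C * h x ^+ p.

Lemma order_h_eq e f : e =1 f -> order_h f -> order_h e.
Proof. by move=> /funext ->. Qed.

Lemma order_h0 : order_h (fun=> 0).
Proof. by exists 0, 1; split=> // x _; rewrite normr0 mul0r. Qed.

Lemma order_hD e f : order_h e -> order_h f -> order_h (fun x => e x + f x).
Proof.
move=> [C [r [r0 eC]]] [C' [r' [r'0 fC]]].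
exists (C + C'), (Num.min r r'); split; first by rewrite lt_min r0.
move=> x; rewrite lt_min => /andP[xr xr']; rewrite mulrDl.
by apply: le_trans (ler_normD _ _) _; rewrite lerD ?eC ?fC.
Qed.

Lemma order_hM (K : R) b e : (forall x, `|b x| <= K) -> order_h e ->
  order_h (fun x => b x * e x).
Proof.
move=> bK [C [r [r0 eC]]]; exists (K * C), r; split=> // x xr.
by rewrite normrM -mulrA ler_pM // eC.
Qed.

Lemma order_hZ (a : R) e : order_h e -> order_h (fun x => a * e x).
Proof. exact: (order_hM (K := `|a|) (b := fun=> a)). Qed.

Lemma order_h_norm e : order_h e -> order_h (fun x => `|e x|).
Proof.
by move=> [C [r [r0 eC]]]; exists C, r; split=> // x xr; rewrite normr_id eC.
Qed.

Lemma order_h_sum n (e : 'I_n -> X -> R) :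
  (forall j, order_h (e j)) -> order_h (fun x => \sum_j e j x).
Proof.
elim: n e => [|n IH] e he.
  by under eq_fun do rewrite big_ord0; exact: order_h0.
by under eq_fun do rewrite big_ord_recl; apply: order_hD => //; exact: IH.
Qed.

End Order.

Section Family.
Context {R : realType} {d np nf nfac : nat} {J : Type}.
Context (M : J -> mesh R d np nf nfac) (p : nat).

(** All nodes of all elements of the family at once: an [order_h] bound over
    this type is uniform in the mesh, the element and the node. *)
Definition mesh_node : Type := {j : J & ('I_(nelt (M j)) * 'I_np)%type}.

Definition node_h (x : mesh_node) : R := hsize (projT2 x).1.

Lemma is_Ohp_node (err : forall j, 'I_(nelt (M j)) -> 'cV[R]_np) :
  is_Ohp M p err ->
  order_h node_h p (fun x => err (projT1 x) (projT2 x).1 (projT2 x).2 0).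
Proof.
by move=> [C [r [r0 eC]]]; exists C, r; split=> // -[j [k m]] xr; exact: eC.
Qed.

(** The finitely many components share the sum of their constants and the
    smallest of their thresholds. *)
Lemma is_Ohp_stacked n (err : forall j, 'I_(nelt (M j)) -> 'cV[R]_(np * n)) :
  (forall c, order_h node_h p (fun x =>
     err (projT1 x) (projT2 x).1 (mxtens_index ((projT2 x).2, c)) 0)) ->
  is_Ohp M p err.
Proof.
move=> he.
have [C [r [r0 eC]]] := order_h_sum (fun c => order_h_norm (he c)).
exists C, r; split=> // j k kr a; case: (mxtens_indexP a) => m c.
have := eC (existT _ j (k, m)) kr; rewrite /= ger0_norm ?sumr_ge0 //.
by apply: le_trans; rewrite (bigD1 c) //= lerDl sumr_ge0.
Qed.

End Family.

(** * Accuracy of the entropy-split scheme *)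

Theorem theorem1 (R : realType) (d p pgeom np nf nfac : nat)
  (hd : (0 < d <= 3)%N)
  (hgeom2 : d = 2%N -> (pgeom <= p.+1)%N)
  (hgeom3 : d = 3%N -> (pgeom <= p./2.+1)%N)
  (alpha : R) (halpha : 0 < alpha \/ alpha < - gamma R)
  (L : 'M[R]_d) (hL : L \in unitmx)
  (E : ref_element R d nfac) (hE : is_ref_element E)
  (J : Type) (M : J -> mesh R d np nf nfac)
  (htess : forall j, is_tessellation L pgeom E (M j))
  (hnodes : forall j, are_nodes L E (M j))
  (hSBP : forall j, is_SBP p E (M j))
  (hacc : accurate_operators L p E M)
  (T : set R) (hT : open T)
  (U : R -> 'rV[R]_d -> 'rV[R]_d.+2)
  (hsol : euler_solution L T U)
  (hsmooth : forall t, T t -> forall c, Cn p.+1 (fun x => U t x 0 c)) :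
  forall t, T t ->
    is_Ohp M p (fun j k =>
      volume_terms alpha E (nodal (M j) (U t)) k
      - SAT alpha E (nodal (M j) (U t)) k
      - stack (nodal (M j) (div_flux (U t)) k)) /\
    is_Ohp M p (fun j k =>
      stack (nodal (M j) (dt U t) k)
      + volume_terms alpha E (nodal (M j) (U t)) k
      - SAT alpha E (nodal (M j) (U t)) k).
Proof.
move=> t Tt; set V := U t.
have aV x : admissible (V x) by exact: (sol_admissible hsol).
have pV : Defs.periodic L V by exact: (sol_periodic hsol).
have smV c : Ck_on p.+1 setT (fun y => V y 0 c).
  by apply/Cn_Ck_on; exact: hsmooth.
have smV1 c : Ck_on 1 setT (fun y => V y 0 c).
  by elim: (p) (smV c) => // k IH /Ck_onW.
have ferr i c : order_h (@node_h R d np nf nfac J M) p (fun x =>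
    operator_error E (projT2 x).1 i (fun y => flux i (V y) 0 c)
      (projT2 x).2 0).
  apply: (is_Ohp_node (err := fun j k => operator_error E k i _)).
  apply: hacc; first by move=> x z; rewrite pV.
  by apply/Cn_Ck_on; exact: Ck_on_flux.
have werr i b : order_h (@node_h R d np nf nfac J M) p (fun x =>
    operator_error E (projT2 x).1 i (fun y => entropy_var alpha (V y) 0 b)
      (projT2 x).2 0).
  apply: (is_Ohp_node (err := fun j k => operator_error E k i _)).
  apply: hacc; first by move=> x z; rewrite pV.
  apply/Cn_Ck_on; under eq_fun do rewrite entropy_varE //.
  exact: Ck_on_entropy_var_closed.
have first_claim : is_Ohp M p (fun j k =>
    volume_terms alpha E (nodal (M j) V) k - SAT alpha E (nodal (M j) V) k
    - stack (nodal (M j) (div_flux V) k)).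
  apply: is_Ohp_stacked => c.
  apply: (@order_h_eq _ _ _ _ _ (fun x =>
    beta alpha / (beta alpha + 1) *
      (\sum_i operator_error E (projT2 x).1 i (fun y => flux i (V y) 0 c)
         (projT2 x).2 0) +
    (beta alpha + 1)^-1 *
      \sum_i \sum_b Atilde alpha i (V (node (projT2 x).1 (projT2 x).2)) c b *
        operator_error E (projT2 x).1 i (fun y => entropy_var alpha (V y) 0 b)
          (projT2 x).2 0)).
    move=> [j [k m]] /=; rewrite -volume_error //.
    rewrite (SAT_eq0 halpha (hnodes _) (hSBP _) pV aV) subr0.
    by rewrite [LHS]mxE [X in _ + X]mxE stackE.
  apply: order_hD; apply: order_hZ; apply: order_h_sum => i //.
  apply: order_h_sum => b.
  (* The operator error is multiplied by a coefficient that is bounded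
     independently of the mesh, being continuous and periodic. *)
  have [||K AK] := periodic_bounded hL (f := fun x => Atilde alpha i (V x) c b).
  - by move=> x z; rewrite pV.
  - exact: continuous_Atilde.
  by apply: (order_hM (K := K)).
split=> //; have [C [r [r0 errC]]] := first_claim.
exists C, r; split=> // j k kr a.
have -> : stack (nodal (M j) (dt U t) k) = - stack (nodal (M j) (div_flux V) k).
  apply/colP => b; case: (mxtens_indexP b) => m c.
  rewrite stackE [RHS]mxE stackE /nodal.
  have /rowP/(_ c) := sol_eq hsol (node k m) Tt.
  by rewrite [LHS]mxE [RHS]mxE => /eqP; rewrite addr_eq0 => /eqP.
by rewrite -addrA addrC; exact: errC.
Qed.
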